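(* Let $d,k\ge 1$, let $\mu=(\mu_1,\dots,\mu_k)$ be a vector of Borel probability measures on $\mathbb{R}^d$, let $\nu$ be a Borel probability measure on $\mathbb{R}^d$ which is quasi-Ahlfors regular with some index $\alpha>0$, let $q\in\mathbb{R}^k$, $t\in\mathbb{R}$, and let $E\subset S_\mu\cap S_\nu$ be a Borel set. Let $$\underline{K}=\{x\in E:\underline{D}_{\mu,\nu}^{q,t}(x,E)=1\},\qquad \overline{K}=\{x\in E:\overline{D}_{\mu,\nu}^{q,t}(x,E)=1\},$$ $$\underline{T}=\{x\in E:\underline{\Delta}_{\mu,\nu}^{q,t}(x,E)=1\},\qquad \overline{T}=\{x\in E:\overline{\Delta}_{\mu,\nu}^{q,t}(x,E)=1\},$$ $K=\underline{K}\cap\overline{K}$ and $T=\overline{T}\cap\underline{T}$. Then: 1. If $\mathcal{H}_{\mu,\nu}^{q,t}(E)<\infty$ and $\mu,\nu\in P_D(\mathbb{R}^d)$, then $\dim_{\mu,\nu}^q(\overline{K})=t$. 2. If $\mathcal{P}_{\mu,\nu}^{q,t}(E)<\infty$, then $\mathrm{Dim}_{\mu,\nu}^q(\underline{T})=t$. 3. If $\mathcal{P}_{\mu,\nu}^{q,t}(E)<\infty$ and $\mu,\nu\in P_D(\mathbb{R}^d)$, then the following are equivalent: (a) $\mathcal{H}_{\mu,\nu}^{q,t}=\mathcal{P}_{\mu,\nu}^{q,t}$ on $E$, i.e. $\mathcal{H}_{\mu,\nu}^{q,t}(F)=\mathcal{P}_{\mu,\nu}^{q,t}(F)$ for every Borel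 set $F\subseteq E$; (b) $\overline{D}_{\mu,\nu}^{q,t}(x,E)=\underline{D}_{\mu,\nu}^{q,t}(x,E)=1$ for $\mathcal{P}_{\mu,\nu}^{q,t}$-almost all $x\in E$; (c) $\overline{\Delta}_{\mu,\nu}^{q,t}(x,E)=\underline{\Delta}_{\mu,\nu}^{q,t}(x,E)=1$ for $\mathcal{P}_{\mu,\nu}^{q,t}$-almost all $x\in E$. 4. If $\mathcal{H}_{\mu,\nu}^{q,t}=\mathcal{P}_{\mu,\nu}^{q,t}<\infty$ on $E$ (i.e. $\mathcal{H}_{\mu,\nu}^{q,t}(F)=\mathcal{P}_{\mu,\nu}^{q,t}(F)<\infty$ for every Borel $F\subseteq E$) and $\mu,\nu\in P_D(\mathbb{R}^d)$, then $\dim_{\mu,\nu}^q(K)=\dim_{\mu,\nu}^q(T)=t$.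
   Context: Notation. $B(x,r)$ is the closed ball of centre $x$ and radius $r$ in $\mathbb{R}^d$; $|U|$ is the diameter of $U$. $S_\lambda$ is the topological support of a measure $\lambda$, and $S_\mu=\bigcap_{i=1}^k S_{\mu_i}$ for the vector $\mu$. For $q\in\mathbb{R}^k$ write $\mu(B(x,r))^q=\prod_{i=1}^k \mu_i(B(x,r))^{q_i}$. Quasi-Ahlfors regularity. A Borel probability measure $\nu$ on $\mathbb{R}^d$ is quasi-Ahlfors regular with index $\alpha>0$ if $\limsup_{|U|\to 0}\nu(U)/|U|^{\alpha}<+\infty$, i.e. there are $M,\delta>0$ with $\nu(U)\le M|U|^\alpha$ for all Borel $U$ with $0<|U|<\delta$. Doubling measures. For $a>1$ and a single Borel probability measure $\lambda$ put $P_a(\lambda)=\limsup_{r\downarrow0}\big(\sup_{x\in S_\lambda}\lambda(B(x,ar))/\lambda(B(x,r))\big)$; for a vector put $P_a(\mu)=\prod_{i=1}^kP_a(\mu_i)$. $P_D(\mathbb{R}^d)$ is the set of (vectors of) Borel probability measures $\lambda$ with $P_a(\lambda)<\infty$ for some $a>1$. Coverings and packings. A centred $\delta$-covering of $E$ is a countable family of balls $(B(x_i,r_i))_i$ with $x_i\in E$, $0<r_i\le\delta$, and $E\subseteq\bigcup_i B(x_i,r_i)$. A centred $\delta$-packing of $E$ is a countable family of pairwise disjoint balls $(B(x_i,r_i))_i$ with $x_i\in E$, $0<r_i\le\delta$. Mixed multifractal Hausdorff measure: for $E\subseteq\mathbb{R}^d$, $$\overline{\mathcal{H}}_{\mu,\nu,\delta}^{q,t}(E)=\inf\Big\{\sum_i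 \mu(B(x_i,r_i))^q\,\nu(B(x_i,r_i))^t\Big\},$$ the infimum being over all centred $\delta$-coverings of $E$; $$\overline{\mathcal{H}}_{\mu,\nu}^{q,t}(E)=\sup_{\delta>0}\overline{\mathcal{H}}_{\mu,\nu,\delta}^{q,t}(E),\qquad \mathcal{H}_{\mu,\nu}^{q,t}(E)=\sup_{F\subseteq E}\overline{\mathcal{H}}_{\mu,\nu}^{q,t}(F).$$ Mixed multifractal packing measure: $$\overline{\mathcal{P}}_{\mu,\nu,\delta}^{q,t}(E)=\sup\Big\{\sum_i \mu(B(x_i,r_i))^q\,\nu(B(x_i,r_i))^t\Big\},$$ the supremum being over all centred $\delta$-packings of $E$; $$\overline{\mathcal{P}}_{\mu,\nu}^{q,t}(E)=\inf_{\delta>0}\overline{\mathcal{P}}_{\mu,\nu,\delta}^{q,t}(E),\qquad \mathcal{P}_{\mu,\nu}^{q,t}(E)=\inf_{E\subseteq\bigcup_i E_i}\sum_i\overline{\mathcal{P}}_{\mu,\nu}^{q,t}(E_i),$$ the last infimum being over countable covers $(E_i)$ of $E$. All these quantities are $0$ for $E=\emptyset$. $\mathcal{H}_{\mu,\nu}^{q,t}$ and $\mathcal{P}_{\mu,\nu}^{q,t}$ are metric outer measures, hence measures on Borel sets. Dimensions. $\dim_{\mu,\nu}^q(E)\in[-\infty,\infty]$ is the unique number such that $\mathcal{H}_{\mu,\nu}^{q,t}(E)=\infty$ for $t<\dim_{\mu,\nu}^q(E)$ and $\mathcal{H}_{\mu,\nu}^{q,t}(E)=0$ for $t>\dim_{\mu,\nu}^q(E)$;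 $\mathrm{Dim}_{\mu,\nu}^q(E)\in[-\infty,\infty]$ is the unique number such that $\mathcal{P}_{\mu,\nu}^{q,t}(E)=\infty$ for $t<\mathrm{Dim}_{\mu,\nu}^q(E)$ and $\mathcal{P}_{\mu,\nu}^{q,t}(E)=0$ for $t>\mathrm{Dim}_{\mu,\nu}^q(E)$. Densities. For a Borel measure $\theta$ and $x\in S_\mu\cap S_\nu$, $$\overline{d}_{\mu,\nu}^{q,t}(x,\theta)=\limsup_{r\to0}\frac{\theta(B(x,r))}{\mu(B(x,r))^q\,\nu(B(x,r))^t},\qquad \underline{d}_{\mu,\nu}^{q,t}(x,\theta)=\liminf_{r\to0}\frac{\theta(B(x,r))}{\mu(B(x,r))^q\,\nu(B(x,r))^t}.$$ For a Borel set $E$, $\overline{D}_{\mu,\nu}^{q,t}(x,E)$ and $\underline{D}_{\mu,\nu}^{q,t}(x,E)$ denote $\overline{d}_{\mu,\nu}^{q,t}(x,\theta)$ and $\underline{d}_{\mu,\nu}^{q,t}(x,\theta)$ for $\theta(A)=\mathcal{H}_{\mu,\nu}^{q,t}(E\cap A)$; $\overline{\Delta}_{\mu,\nu}^{q,t}(x,E)$ and $\underline{\Delta}_{\mu,\nu}^{q,t}(x,E)$ denote the same upper and lower densities for $\theta(A)=\mathcal{P}_{\mu,\nu}^{q,t}(E\cap A)$.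
   Formalization: Parts 1 and 4 additionally assume H(E) > 0 and part 2 assumes P(E) > 0; without this the claims fail (e.g. E empty: the sets K̄, T̲, K, T are empty and have dimension −∞, not t). *)

(* Defs.v *)
From HB Require Import structures.
From mathcomp Require Import all_boot all_order all_algebra.
From mathcomp Require Import all_classical all_reals all_analysis.
Import Order.TTheory GRing.Theory Num.Theory.
Import numFieldNormedType.Exports.

Set Implicit Arguments.
Unset Strict Implicit.
Unset Printing Implicit Defensive.

Local Open Scope classical_set_scope.
Local Open Scope ring_scope.

(* R^d with its Borel sigma-algebra.  The library topology of 'rV[R]_d comes
   from the sup norm; it is the usual topology, so the Borel sets are the usual
   ones.  Balls and diameters below are Euclidean, not sup-norm. *)
Notation borelRd R d := (g_sigma_algebraType (@open 'rV[R]_d)).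

Definition edist (R : realType) (d : nat) (x y : 'rV[R]_d) : R :=
  Num.sqrt (\sum_(j < d) (x 0 j - y 0 j) ^+ 2).

Definition ecball (R : realType) (d : nat) (x : 'rV[R]_d) (r : R) :
    set (borelRd R d) :=
  [set y | edist x y <= r].

Local Open Scope ereal_scope.

(* The diameter of the empty set is -oo. *)
Definition ediam (R : realType) (d : nat) (U : set 'rV[R]_d) : \bar R :=
  ereal_sup [set (edist x.1 x.2)%:E | x in U `*` U].

Definition msupport (R : realType) (d : nat)
    (lambda : probability (borelRd R d) R) : set 'rV[R]_d :=
  [set x | forall U : set 'rV[R]_d, open U -> U x -> 0 < lambda U].

Definition quasi_ahlfors (R : realType) (d : nat)
    (nu : probability (borelRd R d) R) (alpha : R) : Prop :=
  exists M delta : R, (0 < M)%R /\ (0 < delta)%R /\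
    forall U : set (borelRd R d), measurable U ->
      0 < ediam U -> ediam U < delta%:E ->
      nu U <= M%:E * (ediam U) `^ alpha.

Definition doubling_ratio (R : realType) (d : nat) (a : R)
    (lambda : probability (borelRd R d) R) : \bar R :=
  limf_esup (fun r : R =>
    ereal_sup [set lambda (ecball x (a * r)) / lambda (ecball x r)
              | x in msupport lambda]) (0%R^'+).

(* P_D(R^d) for vectors; a single measure is a vector of length 1. *)
Definition doubling (R : realType) (d k : nat)
    (lambda : 'I_k -> probability (borelRd R d) R) : Prop :=
  exists a : R, (1 < a)%R /\ \prod_(i < k) doubling_ratio a (lambda i) < +oo.

(* Powers of masses, with 0 ^ s = +oo for s < 0 (the library has 0 `^ s = 0)
   and 0 ^ 0 = 1. *)
Definition mass_pow (R : realType) (x : \bar R) (s : R) : \bar R :=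
  if (x == 0) && (s < 0)%R then +oo else x `^ s.

(* A countable (finite, empty or infinite) family of balls is indexed by a set
   of naturals I; the values of x and r outside I are irrelevant. *)
Definition centred_covering (R : realType) (d : nat) (delta : R)
    (E : set 'rV[R]_d) (I : set nat) (x : nat -> 'rV[R]_d) (r : nat -> R) :
    Prop :=
  (forall i, I i -> E (x i) /\ (0 < r i <= delta)%R) /\
  E `<=` \bigcup_(i in I) ecball (x i) (r i).

Definition centred_packing (R : realType) (d : nat) (delta : R)
    (E : set 'rV[R]_d) (I : set nat) (x : nat -> 'rV[R]_d) (r : nat -> R) :
    Prop :=
  (forall i, I i -> E (x i) /\ (0 < r i <= delta)%R) /\
  trivIset I (fun i => ecball (x i) (r i)).

(* The number s of [-oo, +oo] at which f jumps from +oo to 0.  There is at most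
   one such s; the default -oo is used when there is none. *)
Definition critical_exponent (R : realType) (f : R -> \bar R) : \bar R :=
  xget -oo [set s : \bar R | (forall t : R, t%:E < s -> f t = +oo) /\
                             (forall t : R, s < t%:E -> f t = 0)].

Section mixed_multifractal.
Context (R : realType) (d k : nat).
Variables (mu : 'I_k -> probability (borelRd R d) R)
          (nu : probability (borelRd R d) R) (q : 'I_k -> R).

Definition msupport_vec : set 'rV[R]_d := \bigcap_(i in setT) msupport (mu i).

Definition weight (t : R) (x : 'rV[R]_d) (r : R) : \bar R :=
  (\prod_(i < k) mass_pow (mu i (ecball x r)) (q i)) *
  mass_pow (nu (ecball x r)) t.

Definition hausdorff_delta (t delta : R) (E : set 'rV[R]_d) : \bar R :=
  ereal_inf [set s | exists (I : set nat) (x : nat -> 'rV[R]_d) (r : nat -> R),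
    centred_covering delta E I x r /\
    s = (\esum_(i in I) weight t (x i) (r i))%R].

Definition hausdorff_pre (t : R) (E : set 'rV[R]_d) : \bar R :=
  ereal_sup [set hausdorff_delta t delta E | delta in [set e | (0 < e)%R]].

Definition hausdorff (t : R) (E : set 'rV[R]_d) : \bar R :=
  ereal_sup [set hausdorff_pre t F | F in [set F | F `<=` E]].

Definition packing_delta (t delta : R) (E : set 'rV[R]_d) : \bar R :=
  ereal_sup [set s | exists (I : set nat) (x : nat -> 'rV[R]_d) (r : nat -> R),
    centred_packing delta E I x r /\
    s = (\esum_(i in I) weight t (x i) (r i))%R].

Definition packing_pre (t : R) (E : set 'rV[R]_d) : \bar R :=
  ereal_inf [set packing_delta t delta E | delta in [set e | (0 < e)%R]].

Definition packing (t : R) (E : set 'rV[R]_d) : \bar R :=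
  ereal_inf [set \sum_(0 <= i <oo) packing_pre t (A i) |
    A in [set A : nat -> set 'rV[R]_d | E `<=` \bigcup_i A i]].

Definition hausdorff_dim (E : set 'rV[R]_d) : \bar R :=
  critical_exponent (fun t => hausdorff t E).

Definition packing_dim (E : set 'rV[R]_d) : \bar R :=
  critical_exponent (fun t => packing t E).

Definition upper_density (t : R) (theta : set 'rV[R]_d -> \bar R)
    (x : 'rV[R]_d) : \bar R :=
  limf_esup (fun r : R => theta (ecball x r) / weight t x r) (0%R^'+).

Definition lower_density (t : R) (theta : set 'rV[R]_d -> \bar R)
    (x : 'rV[R]_d) : \bar R :=
  limf_einf (fun r : R => theta (ecball x r) / weight t x r) (0%R^'+).

Definition hausdorff_upper_density (t : R) (E : set 'rV[R]_d) :=
  upper_density t (fun A => hausdorff t (E `&` A)).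

Definition hausdorff_lower_density (t : R) (E : set 'rV[R]_d) :=
  lower_density t (fun A => hausdorff t (E `&` A)).

Definition packing_upper_density (t : R) (E : set 'rV[R]_d) :=
  upper_density t (fun A => packing t (E `&` A)).

Definition packing_lower_density (t : R) (E : set 'rV[R]_d) :=
  lower_density t (fun A => packing t (E `&` A)).

(* P holds at almost all points of E for the packing measure: the exceptional
   set, which need not be Borel, is null for the outer measure. *)
Definition packing_ae (t : R) (E : set 'rV[R]_d) (P : 'rV[R]_d -> Prop) :=
  packing t [set x | E x /\ ~ P x] = 0.

End mixed_multifractal.

(* Main.v *)
From Pilot Require Import Defs.
From HB Require Import structures.
From mathcomp Require Import all_boot all_order all_algebra.
From mathcomp Require Import all_classical all_reals all_analysis.
From mathcomp Require Import measurable_realfun.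
From mathcomp Require Import ring lra.
Import Order.TTheory GRing.Theory Num.Theory.
Import numFieldNormedType.Exports.
Import Pilot.Defs.
Set Implicit Arguments.
Unset Strict Implicit.
Unset Printing Implicit Defensive.
Local Open Scope classical_set_scope.
Local Open Scope ring_scope.

(** Write [m] for the Hausdorff or the packing measure at the exponent [t], and
[theta] for its restriction to [E], a finite Borel measure by Caratheodory's
criterion for metric outer measures.  Everything rests on comparing the mass
[theta (B(x,r))] with the weight of [B(x,r)], the summand in the definition of
both measures.

Suppose that on a set [A] the mass is at most, or at least, [c] times the
weight.  If this holds for all small radii, any covering or packing of [A] by
small balls can be used and [m A] compares with [theta] by the definitions
([outer_le_hausdorff_pre], [packing_le_lower]).  If it holds only for
arbitrarily small radii, one chooses a disjoint family of such balls which
exhausts [A] up to a [theta]-null set; [vitali_besicovitch] provides it for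
every finite Borel measure and every set of centres.  Its source is the
Besicovitch property of Euclidean balls ([besicovitch_colouring]): balls chosen
greedily by size fall into boundedly many disjoint families, one of which
carries a fixed share of the mass.  The null set that is left over is null for
[m] itself, hence harmless ([packing_often_below_null],
[hausdorff_often_above_null]).  Since a Vitali family is both a packing and
almost a covering, the Hausdorff measure is at most the packing measure on
subsets of [E] ([hausdorff_le_packing]).

With [c] on the appropriate side of 1 these comparisons become
[m A <= c * m A] with [c < 1], so [m A = 0].  Hence the upper Hausdorff density
and the lower packing density equal 1 almost everywhere
([hausdorff_upper_density_eq1], [packing_lower_density_eq1]), and the sets in
the first two parts have positive finite measure.  Quasi-Ahlfors regularity
makes [nu (B(x,r))] uniformly small for small [r], so raising the exponent
multiplies the measures by arbitrarily small factors, and positive finite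
measure at [t] means dimension [t] ([hausdorff_dim_eq], [packing_dim_eq]).

For the equivalence: if the two measures agree on Borel subsets of [E], their
densities are the same functions, so the lower ones equal 1 and it remains
to exclude upper densities above 1 ([equal_hausdorff_density_ae]).  Conversely,
each density condition bounds the mass ratio, for radii below [1 / m], on Borel
sets which increase with [m] to almost all of [E]
([packing_le_of_hausdorff_density], [packing_le_of_packing_density]).  These
sets are Borel because the mass of a closed ball is upper semicontinuous in the
centre and right continuous in the radius, so that rational radii decide.  The
last part combines the equivalence with [hausdorff_le_packing]. *)

(** * Euclidean balls *)

Section euclidean.
Context {R : realType} {d : nat}.
Implicit Types (u v x y z : 'rV[R]_d) (r e : R).

Definition enorm v : R := Num.sqrt (\sum_j v 0 j ^+ 2).

Lemma edistE x y : edist x y = enorm (x - y).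
Proof. by rewrite /edist /enorm; under [in RHS]eq_bigr do rewrite !mxE. Qed.

Lemma enorm_ge0 v : 0 <= enorm v. Proof. exact: sqrtr_ge0. Qed.

Lemma enorm_sqr v : enorm v ^+ 2 = \sum_j v 0 j ^+ 2.
Proof. by rewrite sqr_sqrtr// sumr_ge0// => j _; exact: sqr_ge0. Qed.

Lemma enorm0 : enorm 0 = 0.
Proof. by rewrite /enorm big1 ?sqrtr0// => j _; rewrite mxE expr0n. Qed.

Lemma coord_le_enorm v j : `|v 0 j| <= enorm v.
Proof.
rewrite -sqrtr_sqr ler_wsqrtr// (bigD1 j)//= lerDl sumr_ge0// => i _.
exact: sqr_ge0.
Qed.

Lemma enorm_le_coord v e : 0 <= e -> (forall j, `|v 0 j| <= e) ->
  enorm v <= d%:R * e.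
Proof.
move=> e0 ve; have de0 : 0 <= d%:R * e by rewrite mulr_ge0.
rewrite -(ler_pXn2r (_ : 0 < 2)%N) ?nnegrE ?enorm_ge0// enorm_sqr.
apply: (@le_trans _ _ (\sum_(j < d) e ^+ 2)).
  by apply: ler_sum => j _; rewrite -real_normK ?num_real// ler_pXn2r ?nnegrE.
rewrite sumr_const card_ord -[leLHS]mulr_natl exprMn; apply: ler_wpM2r; first exact: sqr_ge0.
by rewrite -natrX ler_nat; case: (d) => // n; rewrite leq_pmulr.
Qed.

Lemma enormN v : enorm (- v) = enorm v.
Proof. by rewrite /enorm; under eq_bigr do rewrite mxE sqrrN. Qed.

Lemma enormZ (a : R) v : enorm (a *: v) = `|a| * enorm v.
Proof.
rewrite /enorm; under eq_bigr do rewrite mxE exprMn.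
by rewrite -mulr_sumr sqrtrM ?sqr_ge0// sqrtr_sqr.
Qed.

Lemma enorm_eq0 v : enorm v = 0 -> v = 0.
Proof.
move=> v0; apply/rowP => j; rewrite mxE; apply/eqP.
by rewrite -normr_le0 -v0 coord_le_enorm.
Qed.

Lemma enormD u v : enorm (u + v) <= enorm u + enorm v.
Proof.
have [->|/eqP u0] := eqVneq u 0; first by rewrite add0r enorm0 add0r.
have [->|/eqP v0] := eqVneq v 0; first by rewrite addr0 enorm0 addr0.
have gt0 w : w <> 0 -> 0 < enorm w.
  by move=> w0; rewrite lt_neqAle enorm_ge0 andbT eq_sym; apply/eqP => /enorm_eq0.
have {}u0 := gt0 _ u0; have {}v0 := gt0 _ v0.
set a := enorm u in u0 *; set b := enorm v in v0 *.
have ab0 : 0 <= a + b by lra.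
rewrite -(ler_pXn2r (_ : 0 < 2)%N) ?nnegrE ?enorm_ge0//.
rewrite enorm_sqr.
(* the cross term of each coordinate by 2 s t <= (b / a) s ^ 2 + (a / b) t ^ 2 *)
apply: (@le_trans _ _ (\sum_j ((1 + b / a) * u 0 j ^+ 2 + (1 + a / b) * v 0 j ^+ 2))).
  apply: ler_sum => j _; rewrite mxE -subr_ge0.
  set s := u 0 j; set t := v 0 j.
  have -> : (1 + b / a) * s ^+ 2 + (1 + a / b) * t ^+ 2 - (s + t) ^+ 2
    = (b * s - a * t) ^+ 2 / (a * b) by field; rewrite !gt_eqF.
  by rewrite divr_ge0 ?sqr_ge0// mulr_ge0 ?ltW.
rewrite big_split/= -!mulr_sumr -!enorm_sqr -/a -/b.
rewrite le_eqVlt; apply/orP; left; apply/eqP; field.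
by rewrite !gt_eqF.
Qed.

Lemma edistxx x : edist x x = 0. Proof. by rewrite edistE subrr enorm0. Qed.

Lemma edistC x y : edist x y = edist y x.
Proof. by rewrite !edistE -enormN opprB. Qed.

Lemma edist_triangle y x z : edist x z <= edist x y + edist y z.
Proof.
rewrite !edistE (le_trans _ (enormD _ _))// le_eqVlt.
by rewrite addrA subrK eqxx.
Qed.

Lemma edist_scale (a : R) x y : edist (a *: x) (a *: y) = `|a| * edist x y.
Proof. by rewrite !edistE -scalerBr enormZ. Qed.

Lemma ecball_center x r : 0 <= r -> ecball x r x.
Proof. by rewrite /ecball/= edistxx. Qed.

Lemma le_ecball x r e : r <= e -> ecball x r `<=` ecball x e.
Proof. by move=> re y /= /le_trans; apply. Qed.

(** The Euclidean metric and the product topology of the row space have the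
same open sets, since the Euclidean norm lies between the sup norm and
[d] times the sup norm. *)
Lemma nbhs_ecball x (U : set 'rV[R]_d) :
  nbhs x U <-> exists2 e, 0 < e & ecball x e `<=` U.
Proof.
split.
  move=> /(@nbhs_ballP R 'rV[R]_d) [e /= e0 eU]; exists (e / 2); first by rewrite divr_gt0.
  move=> y /= xy; apply: eU; split => // i j; rewrite ord1 /ball/=.
  have := coord_le_enorm (x - y) j; rewrite -edistE !mxE => /le_lt_trans; apply.
  by rewrite (le_lt_trans xy)// ltr_pdivrMr// ltr_pMr// ltr1n.
move=> [e e0 eU]; apply/(@nbhs_ballP R 'rV[R]_d).
exists (e / d.+1%:R) => /=; first by rewrite divr_gt0.
move=> y xy; apply: eU; rewrite /ecball/= edistE.
have ed0 : 0 <= e / d.+1%:R by rewrite divr_ge0 ?ltW.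
have /(enorm_le_coord ed0)/le_trans : forall j, `|(x - y) 0 j| <= e / d.+1%:R.
  by move=> j; rewrite !mxE; apply/ltW; exact: (xy.2 0 j).
apply; rewrite mulrCA -[leRHS]mulr1; apply: ler_wpM2l; first exact: ltW.
by rewrite ltW// ltr_pdivrMr// mul1r ltr_nat.
Qed.

Lemma open_ecball (U : set 'rV[R]_d) :
  open U <-> forall x, U x -> exists2 e, 0 < e & ecball x e `<=` U.
Proof.
rewrite openE; split => [oU x /oU|oU x /oU]; by move/nbhs_ecball.
Qed.

Lemma ecball_closed x r : closed (ecball x r : set 'rV[R]_d).
Proof.
rewrite -openC; apply/open_ecball => y /= /negP; rewrite -ltNge => ry.
exists ((edist x y - r) / 2); first by rewrite divr_gt0// subr_gt0.
move=> z; rewrite /ecball/= => yz; apply/negP; rewrite -ltNge.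
have := edist_triangle z x y; rewrite (edistC z y) => xyz; lra.
Qed.

Lemma ecball_measurable x r : measurable (ecball x r : set (borelRd R d)).
Proof.
rewrite -[ecball x r]setCK; apply: measurableC; apply: sub_sigma_algebra.
exact/closed_openC/ecball_closed.
Qed.

Lemma open_measurable_borelRd (U : set (borelRd R d)) :
  open (U : set 'rV[R]_d) -> measurable U.
Proof. exact: sub_sigma_algebra. Qed.

Lemma closed_measurable_borelRd (U : set (borelRd R d)) :
  closed (U : set 'rV[R]_d) -> measurable U.
Proof.
move=> cU; rewrite -[U]setCK; apply: measurableC; apply: open_measurable_borelRd.
exact: closed_openC.
Qed.

End euclidean.

(** * The finite Besicovitch covering argument *)

Section besicovitch.
Context {R : realType} {d : nat}.
Implicit Types (x y z : 'rV[R]_d) (p q : 'rV[R]_d * R).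

(** Pigeonhole on a cubic grid: two points in one cell of side [1 / m] have
distance at most [d / m < e]. *)
Lemma separated_bounded (K e : R) : 0 < e -> exists N, forall s : seq 'rV[R]_d,
  (forall z, z \in s -> enorm z <= K) -> pairwise (fun x y => e <= edist x y) s ->
  (size s <= N)%N.
Proof.
move=> e0; pose m := (Num.truncn (d%:R / e)).+1.
have m0 : (0 : R) < m%:R by rewrite ltr0n.
have em : d%:R * m%:R^-1 < e.
  by rewrite ltr_pdivrMr// mulrC -ltr_pdivrMr// truncnS_gt.
pose L := Num.truncn (2 * K * m%:R).
pose num z (j : 'I_d) := (z 0 j + K) * m%:R.
pose cell z : {ffun 'I_d -> 'I_L.+1} := [ffun j => inord (Num.truncn (num z j))].
exists #|{: {ffun 'I_d -> 'I_L.+1}}| => s sK sep.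
rewrite -(size_map cell) -(card_uniqP _) ?max_card//.
rewrite uniq_pairwise pairwise_map.
apply: (sub_in_pairwise (P := mem s) (r := fun x y => e <= edist x y)) => //.
move=> x y xs ys; apply: contraTN => /eqP /ffunP cxy.
rewrite -ltNge edistE (le_lt_trans _ em)// enorm_le_coord ?invr_ge0//.
have numP z j : z \in s ->
    (Num.truncn (num z j) <= L)%N /\ 0 <= num z j.
  move=> zs; have := le_trans (coord_le_enorm z j) (sK _ zs).
  rewrite ler_norml => /andP[h1 h2]; split; last by rewrite mulr_ge0//; lra.
  by rewrite le_truncn// ler_pM2r//; lra.
move=> j; have := cxy j; rewrite !ffunE => /(congr1 (@nat_of_ord _)).
have [xL x0] := numP x j xs; have [yL y0] := numP y j ys.
rewrite !inordK// => ee.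
have /andP[] := truncn_itv x0; have /andP[] := truncn_itv y0.
rewrite ee -natr1 !mxE => a1 a2 a3 a4.
rewrite -[leRHS]mul1r ler_pdivlMr// -[X in _ * X](gtr0_norm m0) -normrM.
move: a1 a2 a3 a4; rewrite /num => a1 a2 a3 a4.
by rewrite ler_norml; apply/andP; split; lra.
Qed.

Lemma edist_shrink y (c : R) : 0 <= c -> c <= enorm y -> 0 < enorm y ->
  edist ((c / enorm y) *: y) y = enorm y - c.
Proof.
move=> c0 cy y0; rewrite edistE -[X in _ - X]scale1r -scalerBl enormZ.
have : c / enorm y <= 1 by rewrite ler_pdivrMr// mul1r.
rewrite -subr_le0 => /ler0_norm ->; field; exact: lt0r_neq0.
Qed.

(** The radial retraction onto the ball of radius [2 * rho]. *)
Definition clip (rho : R) y :=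
  if enorm y <= 2 * rho then y else (2 * rho / enorm y) *: y.

Lemma enorm_clip rho y : 0 < rho -> enorm (clip rho y) <= 2 * rho.
Proof.
move=> rho0; rewrite /clip; case: ifPn => //; rewrite -ltNge => ry.
have y0 : 0 < enorm y by rewrite (lt_trans _ ry)// mulr_gt0.
rewrite enormZ (@ger0_norm _ (_ / _)); last by rewrite divr_ge0 ?mulr_ge0// ltW.
by rewrite divfK// gt_eqF.
Qed.

(** Two balls that both meet a ball of radius [rho] centred at the origin,
neither containing the origin nor (for the first) the centre of the other:
pulling their centres radially back into the ball of radius [2 rho] keeps
them at distance [rho / 2], because a centre is moved by at most the amount
by which its radius exceeds [rho]. *)
Lemma clip_separated x y (a b rho : R) : 0 < rho -> a < edist x y ->
  b <= 5 / 4 * a -> rho <= 5 / 4 * a -> rho <= 5 / 4 * b ->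
  a < enorm x -> b < enorm y -> enorm x <= a + rho -> enorm y <= b + rho ->
  rho / 2 <= edist (clip rho x) (clip rho y).
Proof.
move=> rho0 axy ba ra rb ax by_ xa yb; rewrite /clip.
have x0 : 0 < enorm x by lra.
have y0 : 0 < enorm y by lra.
case: ifPn => [x2|]; case: ifPn => [y2|]; rewrite -?ltNge.
- lra.
- move=> y2; have sh := @edist_shrink y (2 * rho) ltac:(lra) ltac:(lra) y0.
  have := edist_triangle (2 * rho / enorm y *: y) x y; rewrite sh; lra.
- move=> x2; have sh := @edist_shrink x (2 * rho) ltac:(lra) ltac:(lra) x0.
  have := edist_triangle (2 * rho / enorm x *: x) x y; rewrite (edistC x (_ *: _)) sh; lra.
- move=> y2 x2; have [xy|/ltW yx] := leP (enorm x) (enorm y).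
  + have sh := @edist_shrink y (enorm x) ltac:(lra) xy y0.
    have -> : 2 * rho / enorm y *: y = (2 * rho / enorm x) *: ((enorm x / enorm y) *: y).
      by rewrite scalerA; congr (_ *: _); field; rewrite !gt_eqF.
    rewrite edist_scale (@ger0_norm _ (_ / _)); last by rewrite divr_ge0 ?mulr_ge0// ltW.
    rewrite -ler_pdivrMl ?divr_gt0 ?mulr_gt0//.
    have -> : (2 * rho / enorm x)^-1 * (rho / 2) = enorm x / 4.
      by field; rewrite !gt_eqF.
    have := edist_triangle (enorm x / enorm y *: y) x y; rewrite sh; lra.
  + have sh := @edist_shrink x (enorm y) ltac:(lra) yx x0.
    have -> : 2 * rho / enorm x *: x = (2 * rho / enorm y) *: ((enorm y / enorm x) *: x).
      by rewrite scalerA; congr (_ *: _); field; rewrite !gt_eqF.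
    rewrite edist_scale (@ger0_norm _ (_ / _)); last by rewrite divr_ge0 ?mulr_ge0// ltW.
    rewrite -ler_pdivrMl ?divr_gt0 ?mulr_gt0//.
    have -> : (2 * rho / enorm y)^-1 * (rho / 2) = enorm y / 4.
      by field; rewrite !gt_eqF.
    have := edist_triangle (enorm y / enorm x *: x) x y; rewrite (edistC x (_ *: _)) sh; lra.
Qed.

Definition pball p : set (borelRd R d) := ecball p.1 p.2.

Definition touch p q := edist p.1 q.1 <= p.2 + q.2.

Lemma touchC p q : touch p q = touch q p.
Proof. by rewrite /touch edistC addrC. Qed.

Lemma untouched_disjoint p q : ~~ touch p q -> pball p `&` pball q = set0.
Proof.
rewrite /touch -ltNge => pq; apply/seteqP; split => // z [].
rewrite /pball /ecball/= => pz qz.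
have := edist_triangle z p.1 q.1; rewrite (edistC z); lra.
Qed.

(** The relation of a ball [p] to a ball [q] chosen after it.  The factor 5/4
allows for a supremum of radii that is not attained. *)
Definition greedy p q := (p.2 < edist p.1 q.1) && (q.2 <= 5 / 4 * p.2).

(** Seen from the centre of [p] in units of its radius, the clipped centres of
the earlier balls that touch it are [1 / 2]-separated in a ball of radius 2. *)
Lemma greedy_touch_bounded : exists N, forall p s, 0 < p.2 -> pairwise greedy s ->
  (forall q, q \in s -> greedy q p /\ touch q p) -> (size s <= N)%N.
Proof.
have [N NP] := @separated_bounded 2 (1 / 2) ltac:(lra).
exists N => p s p0 gs sp.
pose f q := p.2^-1 *: clip p.2 (q.1 - p.1).
rewrite -(size_map f); apply: NP.
  move=> _ /mapP[q qs ->]; rewrite /f enormZ ger0_norm; last by rewrite invr_ge0 ltW.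
  rewrite ler_pdivrMl// mulrC; exact: enorm_clip.
rewrite pairwise_map; apply: (sub_in_pairwise (P := mem s) (r := greedy)) => //.
move=> q r /sp[/andP[q1 q2] q3] /sp[/andP[r1 r2] r3] /andP[qr1 qr2].
rewrite /= /f edist_scale (@ger0_norm _ p.2^-1); last by rewrite invr_ge0 ltW.
rewrite ler_pdivlMl// mulrA mulr1.
apply: (@clip_separated _ _ q.2 r.2) => //; rewrite -?edistE//.
by rewrite edistE opprB addrA subrK -edistE.
Qed.

(** A ball takes a colour that is absent from the at most [N] earlier balls
touching it. *)
Lemma besicovitch_colouring : exists N : nat, forall s, pairwise greedy s ->
  (forall p, p \in s -> 0 < p.2) ->
  exists col : 'rV[R]_d * R -> 'I_N.+1,
    forall p q, p \in s -> q \in s -> p != q -> col p = col q -> ~~ touch p q.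
Proof.
have [N NP] := greedy_touch_bounded; exists N.
elim/last_ind => [|s p IH] gsp sp0; first by exists (fun=> ord0).
move: gsp; rewrite -cats1 pairwise_cat /= andbT => /andP[/allrelP gp gs].
have [|col colP] := IH gs.
  by move=> q qs; apply: sp0; rewrite mem_rcons inE qs orbT.
have p0 : 0 < p.2 by apply: sp0; rewrite mem_rcons mem_head.
pose s' := [seq q <- s | touch q p].
have s'N : (size s' <= N)%N.
  apply: (NP p) => //; first exact: pairwise_filter.
  move=> q; rewrite mem_filter => /andP[tq qs]; split => //.
  by apply: gp => //; rewrite inE.
have [c cP] : exists c, c \notin map col s'.
  apply/existsP; rewrite -negb_forall; apply/negP => /forallP allc.
  have : (#|'I_N.+1| <= size (map col s'))%N.
    rewrite (leq_trans _ (card_size (map col s')))// subset_leq_card//.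
    by apply/fintype.subsetP => c _; exact: allc.
  by rewrite card_ord size_map ltnNge s'N.
have pNs : p \notin s.
  apply/negP => ps; have := gp p p ps (mem_head _ _).
  by rewrite /greedy edistxx ltNge (ltW p0).
exists (fun q => if q == p then c else col q) => q r.
have key q' : q' \in s -> c = col q' -> ~~ touch q' p.
  move=> qs' cq; apply: contra cP => tq'; rewrite cq map_f// mem_filter.
  by rewrite tq' qs'.
rewrite !mem_cat !inE => /orP[qs|/eqP->] /orP[rs|/eqP->] qr.
- rewrite ifN; last by apply: contraNneq pNs => <-.
  by rewrite ifN; [exact: colP|apply: contraNneq pNs => <-].
- rewrite eqxx ifN; last by apply: contraNneq pNs => <-.
  by move=> /esym; exact: key.
- rewrite eqxx ifN; last by apply: contraNneq pNs => <-.
  by rewrite touchC; exact: key.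
- by rewrite eqxx in qr.
Qed.

(** Choosing balls in nearly decreasing order of radius; the process stops
because the chosen centres are [rho]-separated and bounded. *)
Lemma greedy_selection (X : set 'rV[R]_d) (r : 'rV[R]_d -> R) (K rho D : R) :
  0 < rho -> (forall x, X x -> enorm x <= K /\ rho <= r x <= D) ->
  exists s, [/\ pairwise greedy s,
    forall p, p \in s -> X p.1 /\ p.2 = r p.1 &
    X `<=` [set y | exists2 p, p \in s & pball p y]].
Proof.
move=> rho0 XP; apply: contrapT => nos.
pose unc (s : seq ('rV[R]_d * R)) := [set y | X y /\ forall p, p \in s -> ~ pball p y].
pose Inv (s : seq ('rV[R]_d * R)) := [/\ pairwise greedy s,
    forall p, p \in s -> X p.1 /\ p.2 = r p.1 &
    forall y p, p \in s -> unc s y -> r y <= 5 / 4 * p.2].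
have [N NP] := @separated_bounded K rho rho0.
suff big n : exists2 s, Inv s & size s = n.
  have [s [gs sX _] sN] := big N.+1.
  suff : (size (map fst s) <= N)%N by rewrite size_map sN ltnn.
  apply: NP.
    by move=> _ /mapP[p ps ->]; apply: (XP _ _).1; exact: (sX _ _).1.
  rewrite pairwise_map; apply: (sub_in_pairwise (P := mem s) (r := greedy)) => //.
    move=> p q ps qs /andP[/ltW + _]; apply: le_trans.
    by have [/XP[_ /andP[+ _]] ->] := sX _ ps.
elim: n => [|n [s [gs sX sr] sn]]; first by exists [::].
have [z uz] : unc s !=set0.
  apply/set0P/negP => /eqP u0; apply: nos; exists s; split => // y Xy.
  apply: contrapT => ny; have : unc s y.
    by split => // p ps py; apply: ny; exists p.
  by rewrite u0.
have hs : has_sup (r @` unc s).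
  split; first by exists (r z), z.
  by exists D => _ [y [Xy _] <-]; have [_ /andP[]] := XP _ Xy.
have [x ux rx] : exists2 x, unc s x & forall y, unc s y -> r y <= 5 / 4 * r x.
  have sup0 : 0 < sup (r @` unc s).
    apply: (@lt_le_trans _ _ (r z)).
      by have [_ /andP[+ _]] := XP _ uz.1; exact: lt_le_trans.
    by apply: ub_le_sup; [exact: hs.2|exists z].
  (* a radius above 4/5 of the supremum *)
  have [_ [x ux <-] xs] := @sup_adherent _ _ (1 / 5 * sup (r @` unc s)) ltac:(lra) hs.
  exists x => // y uy.
  have : r y <= sup (r @` unc s) by apply: ub_le_sup; [exact: hs.2|exists y].
  lra.
exists (rcons s (x, r x)); last by rewrite size_rcons sn.
have sub y : unc (rcons s (x, r x)) y -> unc s y.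
  by move=> [Xy yN]; split => // p ps; apply: yN; rewrite mem_rcons inE ps orbT.
split.
- rewrite -cats1 pairwise_cat gs/= andbT; apply/allrelP => p q ps.
  rewrite inE => /eqP ->; rewrite /greedy/= sr// andbT ltNge; apply/negP.
  exact: ux.2.
- by move=> p; rewrite mem_rcons inE => /orP[/eqP->|/sX//]; split => //; exact: ux.1.
- move=> y p; rewrite mem_rcons inE => /orP[/eqP-> /sub|ps /sub]; first exact: rx.
  exact: sr.
Qed.

End besicovitch.

(** * Metric outer measures *)

Section caratheodory_criterion.
Local Open Scope ereal_scope.
Context {R : realType} {d : nat}.

Definition metric_outer (Phi : set 'rV[R]_d -> \bar R) :=
  forall (A B : set 'rV[R]_d) (e : R), (0 < e)%R ->
    (forall x y, A x -> B y -> (e <= edist x y)%R) ->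
    Phi A + Phi B <= Phi (A `|` B).

Variable Phi : {outer_measure set 'rV[R]_d -> \bar R}.
Hypothesis Phi_metric : metric_outer Phi.

(** Cut [X `&` U] into rings by the distance to the complement of [U].  Metric
additivity makes the masses of the rings summable, so those close to the
complement are negligible, and the rest is at positive distance from it. *)
Lemma open_caratheodory (U : set 'rV[R]_d) : open U -> Phi.-caratheodory U.
Proof.
move=> oU; apply: le_caratheodory_measurable => X.
have [->|Xoo] := eqVneq (Phi X) +oo; first exact: leey.
pose A n := X `&` [set x | forall y, ~ U y -> (n.+1%:R^-1 <= edist x y)%R].
pose ring n := A n.+1 `\` A n.
have AX n : A n `<=` X by move=> x [].
have Amono n m : (n <= m)%N -> A n `<=` A m.
  move=> nm x [Xx Ux]; split => // y /Ux; apply: le_trans.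
  by rewrite lef_pV2 ?posrE// ler_nat.
have sepA n : Phi (A n) + Phi (X `&` ~` U) <= Phi X.
  apply: (@le_trans _ _ (Phi (A n `|` X `&` ~` U))); last first.
    by apply: le_outer_measure => x [/AX|[]].
  have := @Phi_metric (A n) (X `&` ~` U) (n.+1%:R^-1)%R.
  by apply; rewrite ?invr_gt0// => x y [_ +] [_ Uy]; apply.
(* rings whose indices differ by two are at positive distance *)
have sep_ring n : Phi (A n) + Phi (ring n.+1) <= Phi (A n.+2).
  apply: (@le_trans _ _ (Phi (A n `|` ring n.+1))); last first.
    by apply: le_outer_measure => x [|[]//]; apply: Amono; rewrite leqW.
  apply: (@Phi_metric _ _ (n.+1%:R^-1 - n.+2%:R^-1)%R).
    by rewrite subr_gt0 ltf_pV2 ?posrE// ltr_nat.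
  move=> x y [_ Ax] [[Xy _] nAy]; rewrite lerBlDr leNgt; apply/negP => xyn.
  apply: nAy; split => // z /Ax; rewrite !leNgt; apply: contraNN => yz.
  by apply: le_lt_trans (edist_triangle y _ _) _; apply: lt_trans xyn; rewrite ltrD2l.
have half o n : \sum_(k < n) Phi (ring (k.*2 + o)%N) <= Phi (A (n.*2 + o).-1).
  elim: n => [|n IH]; first by rewrite big_ord0 outer_measure_ge0.
  rewrite big_ord_recr/=.
  case: n IH => [|n] IH.
    by rewrite big_ord0 add0e; apply: le_outer_measure => x [].
  by apply: le_trans (sep_ring _); rewrite leeD2r.
have sum_ring n : \sum_(0 <= k < n) Phi (ring k) <= Phi X + Phi X.
  apply: (@le_trans _ _ (\sum_(0 <= k < n.*2) Phi (ring k))).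
    rewrite (big_cat_nat (n := n) _ (m := 0) (p := n.*2))//=; last by rewrite -addnn leq_addr.
    by rewrite leeDl// sume_ge0// => k _; exact: outer_measure_ge0.
  have -> : \sum_(0 <= k < n.*2) Phi (ring k) =
      \sum_(k < n) Phi (ring (k.*2 + 0)%N) + \sum_(k < n) Phi (ring (k.*2 + 1)%N).
    rewrite -big_split/=; elim: n => [|n IH]; first by rewrite big_nil big_ord0.
    by rewrite doubleS !big_nat_recr// IH big_ord_recr/= addn0 addn1 addeA.
  by apply: leeD; apply: (le_trans (half _ _)); exact: le_outer_measure.
have sum_fin : \sum_(0 <= k <oo) Phi (ring k) < +oo.
  apply: (@le_lt_trans _ _ (Phi X + Phi X)); last by rewrite lte_add_pinfty ?ltey.
  apply: lime_le; first by apply: is_cvg_nneseries => k _ _; exact: outer_measure_ge0.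
  by apply: nearW => n; exact: sum_ring.
have tail0 : \sum_(N <= k <oo) Phi (ring k) @[N --> \oo] --> 0.
  by apply: nneseries_tail_cvg => // k _; exact: outer_measure_ge0.
have XU n : Phi (X `&` U) <= Phi (A n) + \sum_(n <= k <oo) Phi (ring k).
  apply: (@le_trans _ _ (Phi (A n `|` \bigcup_(k in ~` `I_n) ring k))).
    apply: le_outer_measure => x [Xx Ux].
    have [e e0 eU] := (open_ecball U).1 oU x Ux.
    have [m Am] : exists m, A m x.
      exists (Num.truncn (e^-1)%R); split => // y nUy; rewrite leNgt; apply/negP => xy.
      apply/nUy/eU; rewrite /ecball/= (le_trans (ltW xy))//.
      by rewrite -[leRHS]invrK lef_pV2 ?posrE ?invr_gt0// ltW// truncnS_gt.
    have [nA|] := pselect (A n x); first by left.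
    move=> nAn; right.
    have [k Ak kmin] := ex_minnP (ex_intro (fun k => `[< A k x >]) m (asboolT Am)).
    have nk : (n < k)%N.
      rewrite ltnNge; apply/negP => kn; apply: nAn; apply: Amono kn _ _.
      exact/asboolP.
    exists k.-1 => /=; first by apply/negP; rewrite -leqNgt -ltnS prednK// (leq_ltn_trans _ nk).
    split; first by rewrite prednK ?(leq_ltn_trans _ nk)//; exact/asboolP.
    move=> Ak1; have := kmin k.-1 (asboolT Ak1).
    by rewrite leqNgt ltn_predL (leq_ltn_trans _ nk).
  by apply: (le_trans (outer_measureU2 _ _ _)); rewrite leeD2l// outer_measure_sigma_subadditive_tail.
have cvX : Phi X + \sum_(n <= k <oo) Phi (ring k) @[n --> \oo] --> Phi X.
  rewrite -[X in _ --> X]adde0; apply: cvgeD => //; last exact: cvg_cst.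
  by rewrite fin_num_adde_defl.
rewrite -(cvg_lim _ cvX)//; apply: lime_ge; first by apply/cvg_ex; exists (Phi X).
apply: nearW => n; apply: (le_trans (leeD2r _ (XU n))).
by rewrite addeAC leeD2r.
Qed.

Lemma borel_caratheodory (B : set (borelRd R d)) : measurable B -> Phi.-caratheodory B.
Proof.
have : <<s @open 'rV[R]_d >> `<=` Phi.-cara.-measurable.
  apply: smallest_sub; last exact: open_caratheodory.
  split => //; [by move=> X mX; rewrite setTD; exact: measurableC |
                by move=> F mF; exact: bigcupT_measurable].
by move=> h mB; exact: h.
Qed.

Section restriction.
Variable E : set (borelRd R d).
Hypothesis mE : measurable E.

Definition outer_restr (B : set (borelRd R d)) : \bar R := Phi (E `&` B).

Let outer_restr0 : outer_restr set0 = 0.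
Proof. by rewrite /outer_restr setI0 outer_measure0. Qed.

Let outer_restr_ge0 B : 0 <= outer_restr B.
Proof. exact: outer_measure_ge0. Qed.

Let outer_restr_sigma : semi_sigma_additive outer_restr.
Proof.
move=> F mF tF mUF; rewrite /outer_restr setI_bigcupr.
have mEF n : Phi.-cara.-measurable (E `&` F n).
  by apply: borel_caratheodory; exact: measurableI.
apply: (@caratheodory_measure_sigma_additive _ _ Phi) => //.
- by apply: trivIset_setIl.
- exact: bigcupT_measurable.
Qed.

HB.instance Definition _ := isMeasure.Build _ (borelRd R d) R outer_restr
  outer_restr0 outer_restr_ge0 outer_restr_sigma.

Lemma outer_restriction_measure : exists theta : {measure set (borelRd R d) -> \bar R},
  forall B, theta B = Phi (E `&` B).
Proof. by exists outer_restr. Qed.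

End restriction.
End caratheodory_criterion.

(** * Regularity of finite Borel measures *)

Section regularity.
Local Open Scope ereal_scope.
Context {R : realType} {d : nat}.
Variable theta : {measure set (borelRd R d) -> \bar R}.

Lemma measure_bigcup_gt (F : (set (borelRd R d))^nat) (a : \bar R) :
  (forall n, measurable (F n)) -> nondecreasing_seq F ->
  a < theta (\bigcup_n F n) -> exists n, a < theta (F n).
Proof.
move=> mF ndF aF; apply: contrapT => /forallNP noF.
have cvF : theta \o F @ \oo --> theta (\bigcup_n F n).
  by apply: nondecreasing_cvg_mu => //; exact: bigcupT_measurable.
suff : theta (\bigcup_n F n) <= a by rewrite leNgt aF.
rewrite -(cvg_lim _ cvF)//; apply: lime_le; first by apply/cvg_ex; eexists; exact: cvF.
by apply: nearW => n; rewrite leNgt; apply/negP; exact: noF.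
Qed.

Hypothesis theta_fin : theta setT < +oo.

Lemma measure_lt_pinfty (B : set (borelRd R d)) : measurable B -> theta B < +oo.
Proof. by move=> mB; apply: le_lt_trans theta_fin; apply: le_measure; rewrite ?inE. Qed.

Lemma measure_fin_num (B : set (borelRd R d)) : measurable B -> theta B \is a fin_num.
Proof. by move=> mB; rewrite ge0_fin_numE ?measure_lt_pinfty. Qed.

Lemma measure_bigcap_lt (F : (set (borelRd R d))^nat) (a : \bar R) :
  (forall n, measurable (F n)) -> nonincreasing_seq F ->
  theta (\bigcap_n F n) < a -> exists n, theta (F n) < a.
Proof.
move=> mF niF aF; apply: contrapT => /forallNP noF.
have cvF : theta \o F @ \oo --> theta (\bigcap_n F n).
  apply: nonincreasing_cvg_mu => //; first exact: measure_lt_pinfty.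
  exact: bigcapT_measurable.
suff : a <= theta (\bigcap_n F n) by rewrite leNgt aF.
rewrite -(cvg_lim _ cvF)//; apply: lime_ge; first by apply/cvg_ex; eexists; exact: cvF.
by apply: nearW => n; rewrite leNgt; apply/negP; exact: noF.
Qed.

Lemma closed_edist_ge (S : set 'rV[R]_d) (e : R) :
  closed [set x | forall y, S y -> (e <= edist x y)%R].
Proof.
rewrite -openC; apply/open_ecball => x /= /existsNP[y /not_implyP[Sy /negP]].
rewrite -ltNge => xy; exists ((e - edist x y) / 2)%R; first by rewrite divr_gt0// subr_gt0.
move=> z; rewrite /ecball/= => xz /(_ y Sy).
have := edist_triangle x z y; rewrite (edistC z x) => ? ?; lra.
Qed.

(** Every Borel set of a finite measure is squeezed between a closed and an open
set: the sets with this property form a sigma-algebra, which contains the open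
sets because these are increasing unions of closed sets. *)
Lemma borel_regularity (A : set (borelRd R d)) (e : R) : measurable A -> (0 < e)%R ->
  exists C U : set (borelRd R d), [/\ closed (C : set 'rV[R]_d),
    open (U : set 'rV[R]_d), C `<=` A, A `<=` U & theta (U `\` C) <= e%:E].
Proof.
pose reg (A : set (borelRd R d)) := forall e : R, (0 < e)%R ->
  exists C U : set (borelRd R d), [/\ closed (C : set 'rV[R]_d),
    open (U : set 'rV[R]_d), C `<=` A, A `<=` U & theta (U `\` C) <= e%:E].
suff : <<s @open 'rV[R]_d >> `<=` reg by move=> + mA e0; exact.
apply: smallest_sub; last first.
  move=> U oU {}e e0.
  pose C n : set (borelRd R d) := [set x | forall y, (~` U) y -> (n.+1%:R^-1 <= edist x y)%R].
  have cC n : closed (C n : set 'rV[R]_d) by exact: closed_edist_ge.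
  have mD n : measurable (U `\` C n : set (borelRd R d)).
    apply: measurableD; first exact: open_measurable_borelRd.
    by apply: closed_measurable_borelRd; exact: cC.
  have [||n Ce] := @measure_bigcap_lt (fun n => U `\` C n) e%:E mD.
  - move=> n m nm; apply/subsetPset => x [Ux nC]; split => // Cx; apply: nC => y /Cx.
    by apply: le_trans; rewrite lef_pV2 ?posrE// ler_nat.
  - rewrite (_ : \bigcap_n _ = set0) ?measure0//.
    apply/seteqP; split => // x UC; have [Ux _] := UC 0%N I.
    have [r r0 rU] := (open_ecball U).1 oU x Ux.
    have [_] := UC (Num.truncn (r^-1)%R) I; apply => y nUy; rewrite leNgt; apply/negP => xy.
    apply/nUy/rU; rewrite /ecball/= (le_trans (ltW xy))//.
    by rewrite -[leRHS]invrK lef_pV2 ?posrE ?invr_gt0// ltW// truncnS_gt.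
  exists (C n), U; split => //; last exact: ltW.
  move=> x Cx; apply: contrapT => /Cx; rewrite edistxx leNgt.
  by rewrite invr_gt0 ltr0n.
split.
- by move=> {}e e0; exists set0, set0; split; [exact: closed0|exact: open0|by []|by []|rewrite setD0 measure0 lee_fin ltW].
- move=> {}A rA {}e /rA [C [U [cC oU CA AU CU]]]; exists (~` U), (~` C); split.
  + exact: open_closedC.
  + exact: closed_openC.
  + by rewrite setTD; exact: subsetC.
  + by rewrite setTD; exact: subsetC.
  + by rewrite setDE setCK setIC -setDE.
- move=> F rF {}e e0.
  have e2 : (0 < e / 2)%R by rewrite divr_gt0.
  have /choice[C /choice[U CU]] : forall n, exists C U : set (borelRd R d),
      [/\ closed (C : set 'rV[R]_d), open (U : set 'rV[R]_d), C `<=` F n, F n `<=` U &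
        theta (U `\` C) <= (e / 2 / (2 ^ n.+1)%:R)%:E].
    by move=> n; apply: rF; rewrite divr_gt0// ltr0n expn_gt0.
  have mC n : measurable (C n) by apply: closed_measurable_borelRd; have [] := CU n.
  have mU n : measurable (U n) by apply: open_measurable_borelRd; have [] := CU n.
  pose Cn n : set (borelRd R d) := \bigcup_(i in `I_n) C i.
  have mCn n : measurable (Cn n) by apply: bigcup_measurable => i _.
  have mbC : measurable (\bigcup_i C i) by exact: bigcupT_measurable.
  have [|||n CnP] := @measure_bigcap_lt (fun n => \bigcup_i C i `\` Cn n) (e / 2)%:E.
  - by move=> n; exact: measurableD.
  - move=> n m nm; apply/subsetPset => x [Cx nC]; split => // -[i /= im Cix].
    by apply: nC; exists i => //=; exact: leq_trans nm.
  - rewrite (_ : \bigcap_n _ = set0) ?measure0//.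
    apply/seteqP; split => // x xC; have [[i _ Cix] _] := xC 0%N I.
    by have [_] := xC i.+1 I; apply; exists i => /=.
  exists (Cn n), (\bigcup_i U i); split.
  - apply: closed_bigcup; first exact: finite_II.
    by move=> i _; have [] := CU i.
  - by apply: bigcup_open => i _; have [] := CU i.
  - by move=> x [i _ Cix]; exists i => //; have [_ _ + _ _] := CU i; exact.
  - by apply: subset_bigcup => i _; have [] := CU i.
  - apply: (@le_trans _ _ (theta ((\bigcup_i (U i `\` C i)) `|` (\bigcup_i C i `\` Cn n)))).
      apply: le_measure; rewrite ?inE.
      + by apply: measurableD => //; exact: bigcupT_measurable.
      + apply: measurableU; last exact: measurableD.
        by apply: bigcupT_measurable => i; exact: measurableD.
      + move=> x [[i _ Uix] nCn]; have [bC|nbC] := pselect ((\bigcup_i C i) x).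
          by right.
        by left; exists i => //; split => // Cix; apply: nbC; exists i.
    have mUC : measurable (\bigcup_i (U i `\` C i)).
      by apply: bigcupT_measurable => i; exact: measurableD.
    have mCC : measurable (\bigcup_i C i `\` Cn n) by exact: measurableD.
    apply: (le_trans (measureU2 _ mUC mCC)).
    rewrite (splitr e) EFinD; apply: leeD; last exact: ltW.
    apply: (le_trans (measure_sigma_subadditive _ _ _ (@subset_refl _ _))).
    + by move=> i; exact: measurableD.
    + by apply: bigcupT_measurable => i; exact: measurableD.
    apply: (le_trans _ (@epsilon_trick0 R (e / 2)%R xpredT _)); last exact: ltW.
    by apply: lee_nneseries => // i _; have [] := CU i.
Qed.

End regularity.

(** * Countable families and Borel hulls *)

Section esum_countable.
Local Open Scope ereal_scope.
Context {R : realType} {T : pointedType}.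

Lemma countable_enum (S : set T) : countable S ->
  exists (I : set nat) (x : nat -> T), set_bij I S x.
Proof.
move=> /countable_bijP[I]; rewrite card_eq_sym => /card_set_bijP[x xb].
by exists I, x.
Qed.

Lemma outer_measure_esum (U : Type) (Phi : {outer_measure set U -> \bar R})
  (S : set T) (F : T -> set U) : countable S ->
  Phi (\bigcup_(p in S) F p) <= \esum_(p in S) Phi (F p).
Proof.
move=> /countable_enum[I [x xb]].
rewrite (reindex_esum I S x)// esum_mkcond -nneseries_esumT; last first.
  by move=> n; case: ifPn => // _; exact: outer_measure_ge0.
have [_ _ sx] := xb.
apply: (@le_trans _ _ (Phi (\bigcup_n if n \in I then F (x n) else set0))).
  apply: le_outer_measure => u [p /sx[n In <-] Fu]; exists n => //.
  by rewrite mem_set.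
apply: (le_trans (outer_measure_sigma_subadditive _ _)).
apply: lee_nneseries => [n _ _|n _]; first exact: outer_measure_ge0.
by case: ifPn => // _; rewrite outer_measure0.
Qed.

Lemma esum_le_measure (D : measure_display) (U : measurableType D)
  (theta : {measure set U -> \bar R}) (S : set T) (F : T -> set U) (V : set U) :
  measurable V -> (forall p, S p -> measurable (F p) /\ F p `<=` V) ->
  trivIset S F -> \esum_(p in S) theta (F p) <= theta V.
Proof.
move=> mV FV tF; apply: ge_ereal_sup => _ [J [fJ JS] <-].
rewrite -measure_fin_bigcup//; last by move=> p /JS /FV[].
- apply: le_measure; rewrite ?inE//.
    by apply: fin_bigcup_measurable => // p /JS /FV[].
  by move=> u [p /JS /FV[_ +]]; exact.
- exact: sub_trivIset tF.
Qed.

End esum_countable.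

Section measure_hull.
Local Open Scope ereal_scope.
Context {R : realType} {d : nat}.
Variable theta : {measure set (borelRd R d) -> \bar R}.
Hypothesis theta_fin : theta setT < +oo.
Implicit Types X : set (borelRd R d).
Local Notation "theta ^*" := (mu_ext theta).

Lemma mu_ext_fin_num X : theta^* X \is a fin_num.
Proof.
rewrite ge0_fin_numE ?mu_ext_ge0//; apply: le_lt_trans theta_fin.
by rewrite -(measurable_mu_extE _ measurableT); exact: le_mu_ext.
Qed.

Lemma mu_ext_hull X (a : \bar R) : theta^* X < a ->
  exists B, [/\ measurable B, X `<=` B & theta B < a].
Proof.
move=> /ereal_inf_lt[_ [F [mF XF] <-] Fa]; exists (\bigcup_n F n); split => //.
  exact: bigcupT_measurable.
apply: le_lt_trans Fa; apply: measure_sigma_subadditive => //.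
exact: bigcupT_measurable.
Qed.

Lemma mu_ext_null_hull X : theta^* X = 0 ->
  exists B, [/\ measurable B, X `<=` B & theta B = 0].
Proof.
move=> X0; have /choice[B BP] : forall n : nat, exists B,
    [/\ measurable B, X `<=` B & theta B < (n.+1%:R^-1)%:E].
  by move=> n; apply: mu_ext_hull; rewrite X0 lte_fin invr_gt0.
exists (\bigcap_n B n); split.
- by apply: bigcapT_measurable => n; have [] := BP n.
- by move=> x Xx n _; have [_ + _] := BP n; exact.
- apply/eqP; rewrite eq_le measure_ge0 andbT; apply/lee_addgt0Pr => e e0.
  rewrite add0e; have [mB _ Be] := BP (Num.truncn (e^-1)%R).
  apply: (@le_trans _ _ (theta (B (Num.truncn (e^-1)%R)))).
    apply: le_measure; rewrite ?inE//; last by apply: bigcap_inf.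
    by apply: bigcapT_measurable => n; have [] := BP n.
  apply: (le_trans (ltW Be)); rewrite lee_fin -[leRHS]invrK.
  by rewrite lef_pV2 ?posrE ?invr_gt0// ltW// truncnS_gt.
Qed.

(** Outer measures induced by a measure are continuous along increasing unions
of arbitrary sets: intersect the tails of a sequence of Borel hulls. *)
Lemma mu_ext_bigcup_le (X : nat -> set (borelRd R d)) (a : R) :
  nondecreasing_seq X -> (forall n, theta^* (X n) <= a%:E) ->
  theta^* (\bigcup_n X n) <= a%:E.
Proof.
move=> ndX Xa; apply/lee_addgt0Pr => e e0.
have /choice[B BP] : forall n : nat, exists B,
    [/\ measurable B, X n `<=` B & theta B < a%:E + e%:E].
  by move=> n; apply: mu_ext_hull; rewrite (le_lt_trans (Xa n))// lte_fin ltrDl.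
pose C n := \bigcap_(m in [set m | (n <= m)%N]) B m.
have mC n : measurable (C n).
  by apply: bigcap_measurable => [|m _]; [exists n => /=|have [] := BP m].
have XC n : X n `<=` C n.
  move=> x Xx m /= nm; have [_ + _] := BP m; apply.
  exact: (subsetPset _ _ (ndX _ _ nm)) _ Xx.
apply: (@le_trans _ _ (theta (\bigcup_n C n))).
  rewrite -measurable_mu_extE; last exact: bigcupT_measurable.
  exact/le_mu_ext/subset_bigcup.
rewrite leNgt; apply/negP => /(measure_bigcup_gt mC) [].
  move=> n m nm; apply/subsetPset => x Cx k /= mk; apply: Cx => /=.
  exact: leq_trans nm mk.
move=> n; apply/negP; rewrite -leNgt; have [mB _ /ltW] := BP n; apply: le_trans.
by apply: le_measure; rewrite ?inE// => x /(_ n); apply => /=.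
Qed.

End measure_hull.

(** * A Vitali covering theorem for finite Borel measures *)

Section vitali.
Local Open Scope ereal_scope.
Context {R : realType} {d : nat}.
Variable theta : {measure set (borelRd R d) -> \bar R}.
Hypothesis theta_fin : theta setT < +oo.
Local Notation "theta ^*" := (mu_ext theta).
Implicit Types (Q : 'rV[R]_d -> R -> Prop) (A X : set (borelRd R d)).

Definition fine_at Q A := forall x, A x -> forall e : R, (0 < e)%R ->
  exists2 r : R, (0 < r <= e)%R & Q x r.

Definition pballs (S : set ('rV[R]_d * R)) : set (borelRd R d) :=
  \bigcup_(p in S) pball p.

Definition good_family Q A (s : seq ('rV[R]_d * R)) :=
  (forall p, p \in s -> [/\ A p.1, (0 < p.2)%R & Q p.1 p.2]) /\
  (forall p q, p \in s -> q \in s -> p != q -> ~~ touch p q).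

Lemma pballs_closed (s : seq ('rV[R]_d * R)) :
  closed (pballs [set` s] : set 'rV[R]_d).
Proof.
apply: closed_bigcup; first exact: finite_seq.
by move=> p _; exact: ecball_closed.
Qed.

Lemma pballs_measurable (s : seq ('rV[R]_d * R)) : measurable (pballs [set` s]).
Proof. by apply: closed_measurable_borelRd; exact: pballs_closed. Qed.

(** Finitely many disjoint balls capture a fixed proportion of the mass. The
radii can be bounded below because the points with a large radius exhaust [X];
one colour class of the resulting finite Besicovitch cover has the share. *)
Lemma vitali_step : exists2 eta : R, (0 < eta < 1)%R & forall Q X, fine_at Q X ->
  exists2 s, good_family Q X s & theta^* (X `\` pballs [set` s]) <= eta%:E * theta^* X.
Proof.
have [N colouring] := @besicovitch_colouring R d.
pose c0 : R := ((2 * N.+1%:R)^-1)%R.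
have c00 : (0 < c0)%R by rewrite invr_gt0 mulr_gt0.
have c01 : (c0 < 1)%R.
  rewrite invf_lt1; last by rewrite mulr_gt0.
  have : (1 <= N.+1%:R :> R)%R by rewrite ler1n.
  lra.
exists (1 - c0)%R; first by apply/andP; split; lra.
move=> Q X fQ.
have Xfin := mu_ext_fin_num theta_fin X.
set m := fine (theta^* X); have mE : theta^* X = m%:E by rewrite fineK.
have m0 : (0 <= m)%R by rewrite -lee_fin -mE mu_ext_ge0.
have [m00|mN0] := eqVneq m 0%R.
  exists [::]; first by split.
  rewrite [X in _ <= _ * X]mE m00 mule0; apply: (@le_trans _ _ (theta^* X)).
    by apply: le_mu_ext; exact: subDsetl.
  by rewrite mE m00.
have {m0 mN0}m0 : (0 < m)%R by rewrite lt_neqAle eq_sym mN0.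
have /choice[r rP] : forall x, exists r : R, X x -> (0 < r <= 1)%R /\ Q x r.
  move=> x; have [Xx|nX] := pselect (X x); last by exists 0%R.
  by have [r r1 Qr] := fQ x Xx 1%R ltr01; exists r.
pose Xn (n : nat) := X `&` [set x | (enorm x <= n%:R)%R /\ (n.+1%:R^-1 <= r x)%R].
have ndX : nondecreasing_seq Xn.
  move=> n n' nn; apply/subsetPset => x [Xx [x1 x2]]; split => //; split.
    by rewrite (le_trans x1)// ler_nat.
  by rewrite (le_trans _ x2)// lef_pV2 ?posrE// ler_nat.
have XE : X = \bigcup_n Xn n.
  apply/seteqP; split => [x Xx|x [n _ []//]].
  have [/andP[r0 _] _] := rP x Xx.
  exists (maxn (Num.truncn (enorm x)).+1 (Num.truncn (r x)^-1)%R) => //; split => //; split.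
    by rewrite ltW// (lt_le_trans (truncnS_gt _))// ler_nat leq_maxl.
  rewrite -[leRHS]invrK lef_pV2 ?posrE ?invr_gt0// ltW//.
  by rewrite (lt_le_trans (truncnS_gt _))// ler_nat ltnS leq_maxr.
have [n nm] : exists n, (m / 2)%:E < theta^* (Xn n).
  apply: contrapT => /forallNP nX.
  have : theta^* X <= (m / 2)%:E.
    rewrite XE; apply: mu_ext_bigcup_le => // n.
    by rewrite leNgt; apply/negP/nX.
  rewrite mE lee_fin leNgt => /negP; apply.
  by rewrite ltr_pdivrMr// ltr_pMr// ltr1n.
have [||s [gs sX Xs]] := @greedy_selection R d (Xn n) r n%:R n.+1%:R^-1 1.
- by rewrite invr_gt0.
- by move=> x [Xx [-> ->]]; split => //=; have [/andP[]] := rP x Xx.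
have sP p : p \in s -> [/\ X p.1, (0 < p.2)%R & Q p.1 p.2].
  move=> /sX[[Xp _] ->]; have [/andP[? _] ?] := rP _ Xp; by split.
have [|col colP] := colouring s gs; first by move=> p /sP[].
pose sc (i : 'I_N.+1) := [seq p <- s | col p == i].
have cover : theta^* (Xn n) <= \sum_(i < N.+1) theta^* (X `&` pballs [set` sc i]).
  pose F (i : nat) := X `&` pballs [set` sc (inord i)].
  rewrite [leRHS](_ : _ = \sum_(i < N.+1) theta^* (F i)); last first.
    by apply: eq_bigr => i _; rewrite /F inord_val.
  apply: le_trans (@outer_measure_subadditive _ _ (mu_ext theta) F N.+1).
  apply: le_mu_ext => x Xx; rewrite -bigcup_mkord.
  have [p ps px] := Xs x Xx; exists (col p) => /=; first exact: ltn_ord.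
  split; first exact: Xx.1.
  by exists p => //=; rewrite /= mem_filter inord_val eqxx.
have [i vi] : exists i : 'I_N.+1, (m * c0)%:E <= theta^* (X `&` pballs [set` sc i]).
  apply: contrapT => /forallNP nvi.
  have : \sum_(i < N.+1) theta^* (X `&` pballs [set` sc i]) <= \sum_(i < N.+1) (m * c0)%:E.
    by apply: lee_sum => i _; rewrite leNgt; apply/negP => /ltW /nvi.
  rewrite leNgt => /negP; apply; apply: (lt_le_trans _ cover).
  rewrite sumEFin sumr_const card_ord -mulr_natr -mulrA /c0.
  rewrite invfM -mulrA mulVf// mulr1.
  exact: nm.
exists (sc i).
  split => [p|p q]; first by rewrite mem_filter => /andP[_ /sP].
  rewrite !mem_filter => /andP[/eqP pi ps] /andP[/eqP qi qs] pq.
  by apply: colP => //; rewrite pi qi.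
have : theta^* X = theta^* (X `&` pballs [set` sc i]) +
    theta^* (X `\` pballs [set` sc i]).
  by rewrite setDE; exact: caratheodory_measurable_mu_ext (pballs_measurable (sc i)) X.
move: vi.
have := mu_ext_fin_num theta_fin (X `&` pballs [set` sc i]).
have := mu_ext_fin_num theta_fin (X `\` pballs [set` sc i]).
move: (theta^* (X `\` _)) (theta^* (X `&` _)) => [u| |] [v| |]// _ _.
rewrite mE -EFinM !lee_fin => vi [ev]; lra.
Qed.

(** The finitely many balls already chosen are closed, so small balls around an
uncovered point avoid them. *)
Lemma fine_at_avoid Q X (s : seq ('rV[R]_d * R)) : fine_at Q X ->
  fine_at (fun x r => Q x r /\ forall p, p \in s -> ~~ touch (x, r) p)
    (X `\` pballs [set` s]).
Proof.
move=> fQ x [Xx xs] e e0.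
have [e' e'0 e'P] : exists2 e' : R, (0 < e')%R & forall r, (r <= e')%R ->
    forall p, p \in s -> ~~ touch (x, r) p.
  elim: s xs => [|p s IH] xs; first by exists 1%R.
  have [|e' e'0 e'P] := IH.
    by move=> [q qs qx]; apply: xs; exists q => //=; rewrite inE qs orbT.
  have px : (p.2 < edist x p.1)%R.
    rewrite ltNge; apply/negP => px; apply: xs; exists p => //=; first exact: mem_head.
    by rewrite /pball /ecball/= edistC.
  exists (Num.min e' ((edist x p.1 - p.2) / 2))%R.
    by rewrite lt_min e'0 divr_gt0// subr_gt0.
  move=> r; rewrite le_min => /andP[re' rp] q; rewrite inE => /orP[/eqP->|qs].
    rewrite /touch/= -ltNge; lra.
  exact: e'P.
have [|r /andP[r0 re] Qr] := fQ x Xx (Num.min e e')%R; first by rewrite lt_min e0.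
move: re; rewrite le_min => /andP[re re'].
by exists r; [rewrite r0|split => //; exact: e'P].
Qed.

(** Applying [vitali_step] again and again to the part not yet covered makes the
outer measure of that part decrease geometrically. *)
Theorem vitali_besicovitch Q A : fine_at Q A -> exists S : set ('rV[R]_d * R),
  [/\ countable S, forall p, S p -> [/\ A p.1, (0 < p.2)%R & Q p.1 p.2],
    trivIset S pball &
    exists N, [/\ measurable N, A `\` pballs S `<=` N & theta N = 0]].
Proof.
move=> fQ; have [eta /andP[eta0 eta1] step] := vitali_step.
pose rem (s : seq ('rV[R]_d * R)) := theta^* (A `\` pballs [set` s]).
pose T := {s | good_family Q A s}.
pose rel (s s' : T) := {subset sval s <= sval s'} /\ rem (sval s') <= eta%:E * rem (sval s).
have {}step (s : T) : {s' : T | rel s s'}.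
  apply: cid; case: s => s [s1 s2].
  have [s' [s'1 s'2] s'r] := step _ _ (@fine_at_avoid Q A s fQ).
  have gss' : good_family Q A (s ++ s').
    split.
      by move=> p; rewrite mem_cat => /orP[/s1//|/s'1[[Ap _] ? [? _]]].
    move=> p q; rewrite !mem_cat => /orP[ps|ps'] /orP[qs|qs'] pq.
    - exact: s2.
    - have [_ _ [_ +]] := s'1 q qs'; rewrite touchC; case: (q) => q1 q2/=; exact.
    - have [_ _ [_ +]] := s'1 p ps'; case: (p) => p1 p2/=; exact.
    - exact: s'2.
  exists (exist _ _ gss'); split => /=; first by move=> p ps; rewrite mem_cat ps.
  apply: le_trans s'r; apply: le_mu_ext => x [Ax ns]; split; [split => //|].
    by move=> [p ps px]; apply: ns; exists p => //=; rewrite mem_cat ps.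
  by move=> [p ps px]; apply: ns; exists p => //=; rewrite mem_cat ps orbT.
have g0 : good_family Q A [::] by split.
have [f [_ fS]] := dependent_choice step (exist _ _ g0).
have fmono n m : (n <= m)%N -> {subset sval (f n) <= sval (f m)}.
  elim: m => [|m IH]; first by rewrite leqn0 => /eqP->.
  rewrite leq_eqVlt => /orP[/eqP->//|]; rewrite ltnS => /IH h p /h.
  exact: (fS m).1.
pose S := \bigcup_n [set` sval (f n)].
have SP p : S p -> exists n, p \in sval (f n) by move=> [n _ /= ?]; exists n.
have Sgood p q : S p -> S q -> exists2 s, good_family Q A s & (p \in s) && (q \in s).
  move=> /SP[n pn] /SP[m qm]; exists (sval (f (maxn n m))); first exact: svalP.
  by rewrite (fmono n)// ?leq_maxl// (fmono m)// leq_maxr.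
exists S; split.
- by apply: bigcup_countable => // n _; apply: finite_set_countable; exact: finite_seq.
- by move=> p /SP[n pn]; have [+ _] := svalP (f n); exact.
- move=> p q Sp Sq [x px]; apply: contrapT => /eqP pq.
  have [s [_ ds] /andP[ps qs]] := Sgood p q Sp Sq.
  have := untouched_disjoint (ds p q ps qs pq).
  by move/seteqP => [+ _] => /(_ x px).
- apply: mu_ext_null_hull => //.
  have bnd n : theta^* (A `\` pballs S) <= (eta ^+ n)%:E * theta^* A.
    apply: (@le_trans _ _ (rem (sval (f n)))).
      apply: le_mu_ext => x [Ax nS]; split => // -[p pn px]; apply: nS.
      by exists p => //; exists n.
    elim: n => [|n IH].
      by rewrite expr0 mul1e; apply: le_mu_ext; exact: subDsetl.
    apply: (le_trans (fS n).2); rewrite exprS EFinM -muleA.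
    by apply: lee_wpmul2l => //; rewrite lee_fin ltW.
  apply/eqP; rewrite eq_le mu_ext_ge0// andbT.
  have := bnd; rewrite -(fineK (mu_ext_fin_num theta_fin A)).
  rewrite -(fineK (mu_ext_fin_num theta_fin (_ `\` _))).
  set a := fine _; set b := fine _ => {}bnd; rewrite lee_fin.
  have cg : geometric b eta @ \oo --> 0%R.
    by apply: cvg_geometric; rewrite gtr0_norm.
  rewrite -(cvg_lim _ cg)//; apply: limr_ge; first by apply/cvg_ex; exists 0%R.
  by apply: nearW => n; move: (bnd n); rewrite -EFinM lee_fin/= mulrC.
Qed.

End vitali.

(** * The mixed Hausdorff and packing outer measures *)

Section ereal_extra.
Local Open Scope ereal_scope.
Context {R : realType}.

Lemma ereal_sup_add_le (A B : set (\bar R)) (c : \bar R) :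
  A !=set0 -> B !=set0 -> (forall a, A a -> 0 <= a) -> (forall b, B b -> 0 <= b) ->
  (forall a b, A a -> B b -> a + b <= c) -> ereal_sup A + ereal_sup B <= c.
Proof.
move=> [a0 Aa0] [b0 Bb0] A0 B0 ABc.
have c0 : 0 <= c.
  by apply: le_trans (ABc _ _ Aa0 Bb0); apply: adde_ge0; [exact: A0|exact: B0].
case: c c0 ABc => [c| |]// c0 ABc; last exact: leey.
have Afin a : A a -> a \is a fin_num.
  move=> Aa; rewrite ge0_fin_numE ?A0//; apply: le_lt_trans (ltry c).
  by apply: le_trans (ABc _ _ Aa Bb0); rewrite leeDl ?B0.
have supB a : A a -> a + ereal_sup B <= c%:E.
  move=> Aa; rewrite addeC -leeBrDr ?Afin//; apply: ge_ereal_sup => b Bb.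
  by rewrite leeBrDr ?Afin// addeC ABc.
have supB0 : 0 <= ereal_sup B by apply: le_trans (B0 _ Bb0) _; exact: ereal_sup_ubound.
have supBfin : ereal_sup B \is a fin_num.
  rewrite ge0_fin_numE//; apply: le_lt_trans (ltry c).
  by apply: le_trans (supB _ Aa0); rewrite leeDr ?A0.
by rewrite -leeBrDr//; apply: ge_ereal_sup => a Aa; rewrite leeBrDr// supB.
Qed.

(** Turning a family of infima into one: the usual summable slack argument. *)
Lemma sum_inf_le (S : nat -> set (\bar R)) (c : \bar R) :
  (forall n s, S n s -> 0 <= s) ->
  (forall f : nat -> \bar R, (forall n, S n (f n)) -> c <= \sum_(n <oo) f n) ->
  c <= \sum_(n <oo) ereal_inf (S n).
Proof.
move=> S0 Sc.
have i0 n : 0 <= ereal_inf (S n) by apply: le_ereal_inf_tmp => s; exact: S0.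
have [->|foo] := eqVneq (\sum_(n <oo) ereal_inf (S n)) +oo; first exact: leey.
have ifin n : ereal_inf (S n) \is a fin_num.
  rewrite ge0_fin_numE// ltey; apply: contraNneq foo => ioo.
  by apply/eqP; apply: (@nneseries_pinfty _ _ xpredT n).
apply/lee_addgt0Pr => e e0.
have /choice[f fP] : forall n, exists s, S n s /\ s < ereal_inf (S n) + (e / (2 ^ n.+1)%:R)%:E.
  move=> n; have [|s Ss si] := @ereal_inf_lt _ (S n) (ereal_inf (S n) + (e / (2 ^ n.+1)%:R)%:E).
    by rewrite lteDl// lte_fin divr_gt0// ltr0n expn_gt0.
  by exists s.
apply: (le_trans (Sc f _)); first by move=> n; have [] := fP n.
apply: (le_trans _ (epsilon_trick xpredT i0 (ltW e0))).
apply: lee_nneseries => [n _ _|n _]; first by apply: (S0 n); have [] := fP n.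
by apply: ltW; have [] := fP n.
Qed.

End ereal_extra.

Section mixed_measures.
Local Open Scope ereal_scope.
Context {R : realType} {d k : nat}.
Variables (mu : 'I_k -> probability (borelRd R d) R)
          (nu : probability (borelRd R d) R) (q : 'I_k -> R) (t : R).
Implicit Types A B F : set 'rV[R]_d.
Local Notation w := (weight mu nu q t).
Local Notation Hdelta := (hausdorff_delta mu nu q t).
Local Notation Hpre := (hausdorff_pre mu nu q t).
Local Notation H := (hausdorff mu nu q t).
Local Notation Pdelta := (packing_delta mu nu q t).
Local Notation Ppre := (packing_pre mu nu q t).
Local Notation P := (packing mu nu q t).

Lemma weight_ge0 x r : 0 <= w x r.
Proof.
have mp0 (y : \bar R) s : 0 <= mass_pow y s.
  by rewrite /mass_pow; case: ifP => // _; exact: poweR_ge0.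
by rewrite /weight mule_ge0// prode_ge0.
Qed.

(** A countable family may be indexed by any type, in particular by the balls
themselves or by pairs. *)
Lemma hausdorff_delta_le (T : pointedType) (S : set T) (x : T -> 'rV[R]_d)
    (r : T -> R) (delta : R) A : countable S ->
  (forall i, S i -> A (x i) /\ (0 < r i <= delta)%R) ->
  A `<=` \bigcup_(i in S) ecball (x i) (r i) ->
  Hdelta delta A <= \esum_(i in S) w (x i) (r i).
Proof.
move=> /countable_enum[I [f fb]] Sx AS; rewrite (reindex_esum I S f)//.
have [fI _ fS] := fb.
apply: ereal_inf_lbound; exists I, (x \o f), (r \o f); split => //; split.
  by move=> i Ii; apply/Sx/fI.
by move=> y /AS[_ /fS[i Ii <-] yi]; exists i.
Qed.

Lemma packing_delta_ge (T : pointedType) (S : set T) (x : T -> 'rV[R]_d)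
    (r : T -> R) (delta : R) A : countable S ->
  (forall i, S i -> A (x i) /\ (0 < r i <= delta)%R) ->
  trivIset S (fun i => ecball (x i) (r i)) ->
  \esum_(i in S) w (x i) (r i) <= Pdelta delta A.
Proof.
move=> /countable_enum[I [f fb]] Sx tS; rewrite (reindex_esum I S f)//.
have [fI injf fS] := fb.
apply: ereal_sup_ubound; exists I, (x \o f), (r \o f); split => //; split.
  by move=> i Ii; apply/Sx/fI.
move=> i j Ii Ij xij; apply: injf; rewrite ?inE//.
by apply: tS => //; exact: fI.
Qed.

Lemma esum_weight_ge0 (T : choiceType) (S : set T) x r : 0 <= \esum_(i in S) w (x i) (r i).
Proof. by apply: esum_ge0 => i _; exact: weight_ge0. Qed.

Lemma hausdorff_delta_ge0 delta A : 0 <= Hdelta delta A.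
Proof. by apply: le_ereal_inf_tmp => _ [I [x [r [_ ->]]]]; exact: esum_weight_ge0. Qed.

Lemma packing_delta_ge0 delta A : 0 <= Pdelta delta A.
Proof.
apply: ereal_sup_ubound; exists set0, (fun=> 0%R), (fun=> 0%R); split.
  by split => // i j [].
by rewrite esum_set0.
Qed.

Lemma le_hausdorff_delta (e delta : R) A : (e <= delta)%R -> Hdelta delta A <= Hdelta e A.
Proof.
move=> ed; apply: ereal_inf_le_tmp => _ [I [x [r [[h1 h2] ->]]]].
exists I, x, r; split => //; split => // i /h1[Ax /andP[r0 re]]; split => //.
by rewrite r0 (le_trans re).
Qed.

Lemma le_packing_delta (e delta : R) A B : (e <= delta)%R -> A `<=` B ->
  Pdelta e A <= Pdelta delta B.
Proof.
move=> ed AB; apply: ereal_sup_le => _ [I [x [r [[h1 h2] ->]]]].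
exists I, x, r; split => //; split => // i /h1[Ax /andP[r0 re]]; split; first exact: AB.
by rewrite r0 (le_trans re).
Qed.

Lemma hausdorff_delta_le_pre delta A : (0 < delta)%R -> Hdelta delta A <= Hpre A.
Proof. by move=> d0; apply: ereal_sup_ubound; exists delta. Qed.

Lemma packing_pre_le_delta delta A : (0 < delta)%R -> Ppre A <= Pdelta delta A.
Proof. by move=> d0; apply: ereal_inf_lbound; exists delta. Qed.

Lemma hausdorff_pre_le A B : A `<=` B -> Hpre A <= H B.
Proof. by move=> AB; apply: ereal_sup_ubound; exists A. Qed.

Lemma hausdorff_pre_ge0 A : 0 <= Hpre A.
Proof. exact: le_trans (hausdorff_delta_ge0 1 A) (hausdorff_delta_le_pre _ ltr01). Qed.

Lemma packing_pre_ge0 A : 0 <= Ppre A.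
Proof. by apply: le_ereal_inf_tmp => _ [e _ <-]; exact: packing_delta_ge0. Qed.

Lemma le_packing_pre A B : A `<=` B -> Ppre A <= Ppre B.
Proof.
move=> AB; apply: le_ereal_inf_tmp => _ [e e0 <-].
exact: le_trans (packing_pre_le_delta _ e0) (le_packing_delta (lexx _) AB).
Qed.

Lemma hausdorff_ge0 A : 0 <= H A.
Proof. exact: le_trans (hausdorff_pre_ge0 A) (hausdorff_pre_le (@subset_refl _ A)). Qed.

Lemma le_hausdorff A B : A `<=` B -> H A <= H B.
Proof.
move=> AB; apply: ge_ereal_sup => _ [F FA <-]; apply: hausdorff_pre_le.
exact: subset_trans AB.
Qed.

Lemma packing_ge0 A : 0 <= P A.
Proof.
apply: le_ereal_inf_tmp => _ [C _ <-]; apply: nneseries_ge0 => n _ _.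
exact: packing_pre_ge0.
Qed.

Lemma le_packing A B : A `<=` B -> P A <= P B.
Proof.
move=> AB; apply: ereal_inf_le_tmp => _ [C BC <-]; exists C => //.
exact: subset_trans AB BC.
Qed.

Lemma packing_le_sum A (C : nat -> set 'rV[R]_d) : A `<=` \bigcup_n C n ->
  P A <= \sum_(n <oo) Ppre (C n).
Proof. by move=> AC; apply: ereal_inf_lbound; exists C. Qed.

Lemma hausdorff_pre_set0 : Hpre set0 = 0.
Proof.
apply/eqP; rewrite eq_le hausdorff_pre_ge0 andbT.
apply: ge_ereal_sup => _ [e e0 <-].
have := @hausdorff_delta_le nat set0 (fun=> 0%R) (fun=> 0%R) e set0 (countable0 _).
by rewrite esum_set0; apply.
Qed.

Lemma packing_pre_set0 : Ppre set0 = 0.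
Proof.
apply/eqP; rewrite eq_le packing_pre_ge0 andbT.
apply: (le_trans (packing_pre_le_delta _ ltr01)).
apply: ge_ereal_sup => _ [I [x [r [[h _] ->]]]].
rewrite (_ : I = set0) ?esum_set0//.
by apply/seteqP; split => // i /h[].
Qed.

Lemma hausdorff0 : H set0 = 0.
Proof.
apply/eqP; rewrite eq_le hausdorff_ge0 andbT.
apply: ge_ereal_sup => _ [F F0 <-]; move: F0 => /=; rewrite subset0 => ->.
by rewrite hausdorff_pre_set0.
Qed.

Lemma packing_le_pre A : P A <= Ppre A.
Proof.
apply: (le_trans (@packing_le_sum A (fun n => if n is 0%N then A else set0) _)).
  by move=> x Ax; exists 0%N.
rewrite nneseries_recl//; last by move=> n _; exact: packing_pre_ge0.
rewrite eseries0 ?adde0//= => -[//|n] _ _; exact: packing_pre_set0.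
Qed.

Lemma packing0 : P set0 = 0.
Proof.
apply/eqP; rewrite eq_le packing_ge0 andbT.
by rewrite -packing_pre_set0 packing_le_pre.
Qed.

Lemma hausdorff_delta_subadditive delta (C : nat -> set 'rV[R]_d) :
  Hdelta delta (\bigcup_n C n) <= \sum_(n <oo) Hdelta delta (C n).
Proof.
apply: sum_inf_le => [n _ [I [x [r [_ ->]]]]|f /choice[I /choice[x /choice[r fP]]]].
  exact: esum_weight_ge0.
rewrite nneseries_esumT; last by move=> n; have [_ ->] := fP n; exact: esum_weight_ge0.
rewrite (@eq_esum _ _ _ _ (fun n => \esum_(i in I n) w (x n i) (r n i))); last first.
  by move=> n _; have [_ ->] := fP n.
rewrite esum_esum => [|n i _ _]; last exact: weight_ge0.
apply: (@hausdorff_delta_le (nat * nat)%type _ (fun k => x k.1 k.2) (fun k => r k.1 k.2)).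
- exact: countableP.
- move=> [n i] [_ /= Ii]; have [[+ _] _] := fP n; move=> /(_ i Ii)[Cx ?].
  by split => //; exists n.
- move=> y [n _ Cy]; have [[_ +] _] := fP n; move=> /(_ y Cy)[i Ii yi].
  by exists (n, i).
Qed.

Lemma hausdorff_delta_set0 delta : Hdelta delta set0 = 0.
Proof.
apply/eqP; rewrite eq_le hausdorff_delta_ge0 andbT.
have := @hausdorff_delta_le nat set0 (fun=> 0%R) (fun=> 0%R) delta set0 (countable0 _).
by rewrite esum_set0; apply.
Qed.

Lemma hausdorff_deltaU delta A B : Hdelta delta (A `|` B) <= Hdelta delta A + Hdelta delta B.
Proof.
have := @hausdorff_delta_subadditive delta (bigcup2 A B).
rewrite bigcup2E => /le_trans; apply.
rewrite nneseries_recl//=; last by move=> n _; exact: hausdorff_delta_ge0.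
rewrite leeD2l// (@nneseries_split _ _ 1 1)/=; last by move=> n _; exact: hausdorff_delta_ge0.
rewrite big_nat1/= eseries0 ?adde0// => -[|[|n]]//= _ _.
exact: hausdorff_delta_set0.
Qed.

Lemma hausdorff_pre_subadditive (C : nat -> set 'rV[R]_d) :
  Hpre (\bigcup_n C n) <= \sum_(n <oo) Hpre (C n).
Proof.
apply: ge_ereal_sup => _ [e e0 <-].
apply: (le_trans (hausdorff_delta_subadditive _ _)).
apply: lee_nneseries => [n _ _|n _]; first exact: hausdorff_delta_ge0.
exact: hausdorff_delta_le_pre.
Qed.

Lemma hausdorff_sigma_subadditive : sigma_subadditive H.
Proof.
move=> C; apply: ge_ereal_sup => _ [F FC <-].
rewrite (_ : F = \bigcup_n (F `&` C n)); last first.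
  by rewrite -setI_bigcupr; apply/esym/setIidPl.
apply: (le_trans (hausdorff_pre_subadditive _)).
apply: lee_nneseries => [n _ _|n _]; first exact: hausdorff_pre_ge0.
by apply: hausdorff_pre_le; exact: subIsetr.
Qed.

Lemma packing_sigma_subadditive : sigma_subadditive P.
Proof.
move=> C.
apply: sum_inf_le => [n _ [D _ <-]|f fS].
  by apply: nneseries_ge0 => i _ _; exact: packing_pre_ge0.
have /choice[D /all_and2[CD fD]] : forall n, exists D : nat -> set 'rV[R]_d,
    C n `<=` \bigcup_i D i /\ \sum_(i <oo) Ppre (D i) = f n.
  by move=> n; have [D ? ?] := fS n; exists D.
rewrite nneseries_esumT; last first.
  by move=> n; rewrite -fD; apply: nneseries_ge0 => i _ _; exact: packing_pre_ge0.
rewrite (@eq_esum _ _ _ _ (fun n => \esum_(i in setT) Ppre (D n i))); last first.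
  by move=> n _; rewrite -fD nneseries_esumT// => i; exact: packing_pre_ge0.
rewrite esum_esum => [|n i _ _]; last exact: packing_pre_ge0.
have /countable_bijP[I] := countableP (setT `*`` (fun=> setT) : set (nat * nat)).
rewrite card_eq_sym => /card_set_bijP[g gb]; rewrite (reindex_esum I _ g)//.
rewrite esum_mkcond -nneseries_esumT; last first.
  by move=> n; case: ifP => // _; exact: packing_pre_ge0.
have [_ _ gs] := gb.
apply: (le_trans (@packing_le_sum _ (fun n => if n \in I then D (g n).1 (g n).2 else set0) _)).
  move=> y [n _ /CD[i _ Dy]]; have [|m Im gm] := gs (n, i) => //.
  by exists m => //; rewrite mem_set// gm.
apply: lee_nneseries => [n _ _|n _]; first exact: packing_pre_ge0.
by case: ifP => //; rewrite packing_pre_set0.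
Qed.

HB.instance Definition _ := isOuterMeasure.Build R 'rV[R]_d H
  hausdorff0 hausdorff_ge0 le_hausdorff hausdorff_sigma_subadditive.

HB.instance Definition _ := isOuterMeasure.Build R 'rV[R]_d P
  packing0 packing_ge0 le_packing packing_sigma_subadditive.

End mixed_measures.

(** * Metric additivity and comparison *)

Section metric_measures.
Local Open Scope ereal_scope.
Context {R : realType} {d k : nat}.
Variables (mu : 'I_k -> probability (borelRd R d) R)
          (nu : probability (borelRd R d) R) (q : 'I_k -> R) (t : R).
Implicit Types A B F G : set 'rV[R]_d.
Local Notation w := (weight mu nu q t).
Local Notation Hdelta := (hausdorff_delta mu nu q t).
Local Notation Hpre := (hausdorff_pre mu nu q t).
Local Notation H := (hausdorff mu nu q t).
Local Notation Pdelta := (packing_delta mu nu q t).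
Local Notation Ppre := (packing_pre mu nu q t).
Local Notation P := (packing mu nu q t).

(** A covering of two distant sets by small balls splits according to the
centres: no ball centred in one set reaches the other. *)
Lemma hausdorff_delta_separated (delta e : R) F G : (delta < e)%R ->
  (forall x y, F x -> G y -> (e <= edist x y)%R) ->
  Hdelta delta F + Hdelta delta G <= Hdelta delta (F `|` G).
Proof.
move=> de sep; apply: le_ereal_inf_tmp => _ [I [x [r [[Ix Icov] ->]]]].
rewrite (esumID [set i | F (x i)]) => [|i _]; last exact: weight_ge0.
have e0 i : I i -> (0 < r i)%R /\ (r i < e)%R.
  by move=> /Ix[_ /andP[r0 rd]]; split => //; exact: le_lt_trans de.
apply: leeD.
- apply: (@hausdorff_delta_le _ _ _ _ _ _ _ nat); first exact: countableP.
    by move=> i [Ii Fi]; split => //; have [] := Ix i Ii.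
  move=> y Fy; have [i Ii yi] := Icov y (or_introl Fy); exists i => //; split => //.
  have [[//|Gx] _] := Ix i Ii; have := sep _ _ Fy Gx; rewrite edistC leNgt => /negP[].
  by apply: le_lt_trans yi _; have [] := e0 i Ii.
- apply: (@hausdorff_delta_le _ _ _ _ _ _ _ nat); first exact: countableP.
    by move=> i [Ii Fi]; split => //; have [[Fx|] ] := Ix i Ii.
  move=> y Gy; have [i Ii yi] := Icov y (or_intror Gy); exists i => //; split => //= Fx.
  have := sep _ _ Fx Gy; rewrite leNgt => /negP[].
  by apply: le_lt_trans yi _; have [] := e0 i Ii.
Qed.

Lemma hausdorff_pre_separated (e : R) F G : (0 < e)%R ->
  (forall x y, F x -> G y -> (e <= edist x y)%R) ->
  Hpre F + Hpre G <= Hpre (F `|` G).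
Proof.
move=> e0 sep; apply: ereal_sup_add_le.
- by exists (Hdelta 1 F); exists 1%R => //=; exact: ltr01.
- by exists (Hdelta 1 G); exists 1%R => //=; exact: ltr01.
- by move=> _ [? _ <-]; exact: hausdorff_delta_ge0.
- by move=> _ [? _ <-]; exact: hausdorff_delta_ge0.
move=> _ _ [d1 /= d10 <-] [d2 /= d20 <-].
pose delta := Num.min (Num.min d1 d2) (e / 2)%R.
have delta0 : (0 < delta)%R by rewrite !lt_min d10 d20/= divr_gt0.
apply: (@le_trans _ _ (Hdelta delta F + Hdelta delta G)).
  by apply: leeD; apply: le_hausdorff_delta; rewrite !ge_min lexx ?orbT.
apply: (le_trans (@hausdorff_delta_separated delta e _ _ _ sep)).
  by rewrite gt_min; apply/orP; right; rewrite ltr_pdivrMr// ltr_pMr// ltr1n.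
exact: hausdorff_delta_le_pre.
Qed.

Lemma hausdorff_metric : metric_outer H.
Proof.
move=> A B e e0 sep; apply: ereal_sup_add_le.
- by exists (Hpre A); exists A.
- by exists (Hpre B); exists B.
- by move=> _ [? _ <-]; exact: hausdorff_pre_ge0.
- by move=> _ [? _ <-]; exact: hausdorff_pre_ge0.
move=> _ _ [F FA <-] [G GB <-].
apply: (le_trans (@hausdorff_pre_separated e _ _ e0 _)).
  by move=> x y /FA Ax /GB By; exact: sep.
apply: hausdorff_pre_le; exact: setUSS.
Qed.

(** Small balls centred in distant sets are disjoint, so two packings form one
packing indexed by the disjoint union of their index sets. *)
Lemma packing_delta_separated (delta e : R) F G : (2 * delta < e)%R ->
  (forall x y, F x -> G y -> (e <= edist x y)%R) ->
  Pdelta delta F + Pdelta delta G <= Pdelta delta (F `|` G).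
Proof.
move=> de sep.
have ne A : [set s | exists (I : set nat) (x : nat -> 'rV[R]_d) (r : nat -> R),
    centred_packing delta A I x r /\
    s = (\esum_(i in I) weight mu nu q t (x i) (r i))%R] !=set0.
  exists 0; exists set0, (fun=> 0%R), (fun=> 0%R); split; last by rewrite esum_set0.
  by split => // i j [].
apply: ereal_sup_add_le => //.
- by move=> _ [I [x [r [_ ->]]]]; exact: esum_weight_ge0.
- by move=> _ [I [x [r [_ ->]]]]; exact: esum_weight_ge0.
move=> _ _ [I [x [r [[Ix It] ->]]]] [J [y [s [[Jy Jt] ->]]]].
pose S : set (bool * nat) := [set u | if u.1 then I u.2 else J u.2].
pose z (u : bool * nat) := if u.1 then x u.2 else y u.2.
pose rho (u : bool * nat) := if u.1 then r u.2 else s u.2.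
have -> : \esum_(i in I) w (x i) (r i) + \esum_(i in J) w (y i) (s i) =
    \esum_(u in S) w (z u) (rho u).
  rewrite [RHS](esumID [set u : bool * nat | u.1]) => [|u _]; last exact: weight_ge0.
  congr (_ + _).
    apply/esym; apply: (reindex_esum I _ (pair true)); split.
    - by move=> i Ii; split.
    - by move=> i j _ _ [].
    - by move=> [[] i] [/= Si //] _; exists i.
  apply/esym; apply: (reindex_esum J _ (pair false)); split.
  - by move=> i Ji; split.
  - by move=> i j _ _ [].
  - by move=> [[] i] [/= Si //] _; exists i.
have far i j u : I i -> J j -> ecball (x i) (r i) u -> ecball (y j) (s j) u -> False.
  move=> /Ix[Fx /andP[_ ri]] /Jy[Gy /andP[_ sj]]; rewrite /ecball/= => xu yu.
  have := sep _ _ Fx Gy; have := edist_triangle u (x i) (y j).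
  rewrite (edistC u); lra.
apply: (@packing_delta_ge _ _ _ _ _ _ _ (bool * nat)%type).
- exact: countableP.
- by move=> [[] i] /= Si; [have [] := Ix i Si|have [] := Jy i Si] => ? ?; split => //; [left|right].
- move=> [[] i] [[] j] /= Si Sj.
  + by move=> ij; congr pair; exact: It.
  + by move=> [u [ui uj]]; have := far _ _ _ Si Sj ui uj.
  + by move=> [u [ui uj]]; have := far _ _ _ Sj Si uj ui.
  + by move=> ij; congr pair; exact: Jt.
Qed.

Lemma packing_pre_separated (e : R) F G : (0 < e)%R ->
  (forall x y, F x -> G y -> (e <= edist x y)%R) ->
  Ppre F + Ppre G <= Ppre (F `|` G).
Proof.
move=> e0 sep; apply: le_ereal_inf_tmp => _ [d1 /= d10 <-].
pose delta := Num.min d1 (e / 3)%R.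
have delta0 : (0 < delta)%R by rewrite !lt_min d10/= divr_gt0.
apply: (@le_trans _ _ (Pdelta delta F + Pdelta delta G)).
  by apply: leeD; exact: packing_pre_le_delta.
apply: (@le_trans _ _ (Pdelta delta (F `|` G))).
  apply: packing_delta_separated sep.
  have : (delta <= e / 3)%R by rewrite ge_min lexx orbT.
  lra.
by apply: le_packing_delta => //; rewrite ge_min lexx.
Qed.

Lemma packing_metric : metric_outer P.
Proof.
move=> A B e e0 sep; apply: le_ereal_inf_tmp => _ [C ABC <-].
apply: (@le_trans _ _ (\sum_(n <oo) Ppre (A `&` C n) + \sum_(n <oo) Ppre (B `&` C n))).
  by apply: leeD; apply: packing_le_sum; rewrite -setI_bigcupr subsetI; split => //;
    apply: subset_trans ABC; [exact: subsetUl|exact: subsetUr].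
rewrite -nneseriesD; [|by move=> *; exact: packing_pre_ge0..].
apply: lee_nneseries => [n _ _|n _].
  by rewrite adde_ge0// packing_pre_ge0.
apply: (le_trans (@packing_pre_separated e _ _ e0 _)).
  by move=> x y [Ax _] [By _]; exact: sep.
by apply: le_packing_pre => x [[]|[]].
Qed.

(** Covering a bounded set by balls of one common radius and splitting them into
boundedly many disjoint families compares the two premeasures. *)
Lemma hausdorff_le_packing_delta : exists N : nat, forall (K delta : R) A,
  (0 < delta)%R -> (forall x, A x -> (enorm x <= K)%R) ->
  Hdelta delta A <= N.+1%:R%:E * Pdelta delta A.
Proof.
have [N colouring] := @besicovitch_colouring R d; exists N.
move=> K delta A d0 AK.
have [|s [gs sA As]] := @greedy_selection R d A (fun=> delta) K delta delta d0.
  by move=> x Ax; split; [exact: AK|rewrite lexx].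
have [|col colP] := colouring s gs; first by move=> p /sA[_ ->].
have sP p : p \in s -> A p.1 /\ (0 < p.2 <= delta)%R.
  by move=> /sA[Ap ->]; rewrite d0 lexx.
apply: (@le_trans _ _ (\esum_(p in [set` s]) w p.1 p.2)).
  apply: (@hausdorff_delta_le _ _ _ _ _ _ _ ('rV[R]_d * R)%type).
  - by apply: finite_set_countable; exact: finite_seq.
  - exact: sP.
  - by move=> x /As[p ps px]; exists p.
rewrite (_ : \esum_(p in _) _ =
    \sum_(i < N.+1) \esum_(p in [set` s] `&` [set p | col p = i]) w p.1 p.2).
  rewrite (_ : N.+1%:R%:E * _ = \sum_(i < N.+1) Pdelta delta A); last first.
    by rewrite sumr_const card_ord mule_natl.
  apply: lee_sum => i _.
  apply: (@packing_delta_ge _ _ _ _ _ _ _ ('rV[R]_d * R)%type).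
  - by apply: finite_set_countable; apply: finite_setIl; exact: finite_seq.
  - by move=> p [/= ps _]; exact: sP.
  - move=> p r [/= ps pi] [/= rs ri] [x xp]; apply: contrapT => /eqP pr.
    have := untouched_disjoint (colP p r ps rs pr _); rewrite pi ri => /(_ erefl).
    by move/seteqP => [+ _] => /(_ x xp).
transitivity (\esum_(p in [set` s]) \sum_(i < N.+1) (if col p == i then w p.1 p.2 else 0)).
  apply: eq_esum => p _; rewrite (bigD1 (col p))//= eqxx big1 ?adde0// => i.
  by rewrite eq_sym => /negbTE ->.
rewrite esum_sum => [|p i _ _]; last by case: ifP => // _; exact: weight_ge0.
apply: eq_bigr => i _; rewrite esum_mkcondr; apply: eq_esum => p _.
by case: eqP => [pi|pi]; [rewrite mem_set|rewrite memNset].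
Qed.

Lemma hausdorff_le_packing_bounded : exists N : nat, forall (K : R) A,
  (forall x, A x -> (enorm x <= K)%R) -> H A <= N.+1%:R%:E * P A.
Proof.
have [N NP] := hausdorff_le_packing_delta; exists N => K A AK.
have N0 : (0 < N.+1%:R :> R)%R by [].
have pre C : (forall x, C x -> (enorm x <= K)%R) -> Hpre C <= N.+1%:R%:E * Ppre C.
  move=> CK; apply: ge_ereal_sup => _ [e /= e0 <-].
  rewrite -lee_pdivrMl//; apply: le_ereal_inf_tmp => _ [e' /= e'0 <-].
  rewrite lee_pdivrMl//; have m0 : (0 < Num.min e e')%R by rewrite lt_min e0.
  apply: (@le_trans _ _ (Hdelta (Num.min e e') C)).
    by apply: le_hausdorff_delta; rewrite ge_min lexx.
  apply: (le_trans (NP K _ _ m0 CK)); apply: lee_wpmul2l => //.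
  by apply: le_packing_delta => //; rewrite ge_min lexx orbT.
apply: ge_ereal_sup => _ [F FA <-].
rewrite -lee_pdivrMl//; apply: le_ereal_inf_tmp => _ [C AC <-].
rewrite lee_pdivrMl// (_ : F = \bigcup_n (F `&` C n)); last first.
  by rewrite -setI_bigcupr; apply/esym/setIidPl/(subset_trans FA).
apply: (le_trans (hausdorff_pre_subadditive _ _ _ _ _)).
rewrite -nneseriesZl; last by move=> n _; exact: packing_pre_ge0.
apply: lee_nneseries => [n _ _|n _]; first exact: hausdorff_pre_ge0.
apply: (@le_trans _ _ (N.+1%:R%:E * Ppre (F `&` C n))).
  by apply: pre => x [/FA + _]; exact: AK.
by apply: lee_wpmul2l => //; apply: le_packing_pre; exact: subIsetr.
Qed.

(** The bounded case suffices, by exhausting [A] by bounded sets. *)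
Lemma packing_null_hausdorff_null A : P A = 0 -> H A = 0.
Proof.
move=> PA0; apply/eqP; rewrite eq_le hausdorff_ge0 andbT.
have [N NP] := hausdorff_le_packing_bounded.
rewrite (_ : A = \bigcup_n (A `&` [set x | (enorm x <= n%:R)%R])); last first.
  apply/seteqP; split => [x Ax|x [n _ []]//].
  by exists (Num.truncn (enorm x)).+1 => //; split => //=; rewrite ltW// truncnS_gt.
apply: (le_trans (outer_measure_sigma_subadditive _ _)).
rewrite eseries0// => n _ _; apply/eqP; rewrite eq_le hausdorff_ge0 andbT.
apply: (le_trans (NP n%:R _ _)); first by move=> x [].
rewrite (_ : P _ = 0) ?mule0//; apply/eqP; rewrite eq_le packing_ge0 andbT -PA0.
by apply: le_packing; exact: subIsetl.
Qed.

End metric_measures.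

(** * Masses of balls and their ratio to the weight *)

Lemma near_right_itv (R : realType) (x : R) (A : set R) :
  nbhs x^'+ A <-> exists2 e, 0 < e & forall y, x < y < x + e -> A y.
Proof.
rewrite /at_right; split.
  rewrite /within /= => /nbhs_ballP[e /= e0 eA]; exists e => // y /andP[xy ye].
  by apply: eA => //; rewrite /ball/= ltr0_norm ?subr_lt0//; lra.
move=> [e e0 eA]; apply/nbhs_ballP; exists e => //= y.
by rewrite /ball/= => ye xy; apply: eA; rewrite ltr0_norm ?subr_lt0// in ye; lra.
Qed.

Section ball_mass.
Local Open Scope ereal_scope.
Context {R : realType} {d : nat}.
Variable theta : {measure set (borelRd R d) -> \bar R}.
Hypothesis theta_fin : theta setT < +oo.
Implicit Types x : 'rV[R]_d.

Definition bmass x (r : R) : R := fine (theta (ecball x r)).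

Lemma bmassE x r : theta (ecball x r) = (bmass x r)%:E.
Proof. by rewrite fineK// measure_fin_num//; exact: ecball_measurable. Qed.

Lemma bmass_ge0 x r : (0 <= bmass x r)%R.
Proof. by rewrite -lee_fin -bmassE measure_ge0. Qed.

Lemma le_bmass x y r e : ecball x r `<=` ecball y e -> (bmass x r <= bmass y e)%R.
Proof.
move=> re; rewrite -lee_fin -!bmassE; apply: le_measure; rewrite ?inE//;
  exact: ecball_measurable.
Qed.

(** A closed ball is the intersection of the larger concentric closed balls. *)
Lemma bmass_outer x (r a : R) : (bmass x r < a)%R ->
  exists2 e : R, (0 < e)%R & (bmass x (r + e) < a)%R.
Proof.
rewrite -lte_fin -bmassE => ra.
have [||n nP] := @measure_bigcap_lt _ _ theta theta_fin
    (fun n => ecball x (r + n.+1%:R^-1)%R) a%:E (fun n => ecball_measurable _ _).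
- move=> n m nm; apply/subsetPset; apply: le_ecball.
  by rewrite lerD2l lef_pV2 ?posrE// ler_nat.
- rewrite (_ : \bigcap_n _ = ecball x r)//; apply/seteqP; split => y.
    move=> xy; rewrite /ecball/= leNgt; apply/negP => rxy.
    have := xy (Num.truncn ((edist x y - r)^-1)%R) I.
    rewrite /ecball/= -lerBlDl leNgt => /negP; apply.
    rewrite -[X in (_ < X)%R]invrK ltf_pV2 ?posrE ?invr_gt0 ?subr_gt0//.
    exact: truncnS_gt.
  by move=> xy n _; move: xy; apply: le_ecball; rewrite lerDl.
by exists (n.+1%:R^-1)%R => //; rewrite -lte_fin -bmassE.
Qed.

Lemma bmass_right_continuous x (r : R) : bmass x e @[e --> r^'+] --> bmass x r.
Proof.
apply/cvgrPdist_lt => e e0.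
have [|e' e'0 e'P] := @bmass_outer x r (bmass x r + e)%R; first by rewrite ltrDl.
near=> s.
have rs : (r < s)%R by near: s; exact: nbhs_right_gt.
have h1 : (bmass x r <= bmass x s)%R by apply/le_bmass/le_ecball/ltW.
have h2 : (bmass x s <= bmass x (r + e'))%R.
  apply/le_bmass/le_ecball; near: s; apply: nbhs_right_le; by rewrite ltrDl.
rewrite distrC ger0_norm ?subr_ge0//; lra.
Unshelve. all: by end_near. Qed.

(** The mass of a closed ball is upper semicontinuous in the centre: a ball
centred nearby lies in a slightly larger concentric ball. *)
Lemma bmass_measurable (r : R) : measurable_fun setT (fun x : borelRd R d => bmass x r).
Proof.
apply: (measurability _ (RGenCInfty.measurableE R)).
move=> /= _ [_ [a ->]] <-; rewrite setTI -[X in measurable X]setCK; apply: measurableC.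
apply: open_measurable_borelRd; apply/open_ecball => x /=.
rewrite in_itv/= andbT => /negP; rewrite -ltNge => xa.
have [e e0 ea] := bmass_outer xa; exists e => // y xy /=.
rewrite in_itv/= andbT; apply/negP; rewrite -ltNge; apply: le_lt_trans ea.
apply: le_bmass => z; rewrite /ecball/= => yz.
by rewrite (le_trans (edist_triangle y _ _))// addrC lerD.
Qed.

End ball_mass.

Section weights.
Local Open Scope ereal_scope.
Context {R : realType} {d k : nat}.
Variables (mu : 'I_k -> probability (borelRd R d) R)
          (nu : probability (borelRd R d) R) (q : 'I_k -> R) (t : R).
Implicit Types x : 'rV[R]_d.
Local Notation S := (msupport_vec mu `&` msupport nu).

Let fin (lambda : probability (borelRd R d) R) : lambda setT < +oo.
Proof. by rewrite probability_setT ltry. Qed.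

Definition rweight x (r : R) : R :=
  (\prod_(i < k) bmass (mu i) x r `^ q i * bmass nu x r `^ t)%R.

Lemma msupport_bmass_gt0 (lambda : probability (borelRd R d) R) x (r : R) :
  msupport lambda x -> (0 < r)%R -> (0 < bmass lambda x r)%R.
Proof.
move=> lx r0; rewrite -lte_fin -(bmassE (fin lambda)).
have : nbhs x (ecball x r) by apply/nbhs_ecball; exists r.
rewrite nbhsE => -[U [oU Ux] Ur]; apply: lt_le_trans (lx _ oU Ux) _.
apply: le_measure; rewrite ?inE//; first exact: open_measurable_borelRd.
exact: ecball_measurable.
Qed.

Lemma mass_powE (a s : R) : (0 < a)%R -> mass_pow a%:E s = (a `^ s)%:E.
Proof. by move=> a0; rewrite /mass_pow eqe gt_eqF//= poweR_EFin. Qed.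

Lemma weightE x (r : R) : S x -> (0 < r)%R ->
  weight mu nu q t x r = (rweight x r)%:E.
Proof.
move=> [mx nx] r0; rewrite /weight /rweight EFinM -prodEFin; congr (_ * _).
  by apply: eq_bigr => i _; rewrite (bmassE (fin _)) mass_powE// msupport_bmass_gt0//; exact: mx.
by rewrite (bmassE (fin _)) mass_powE// msupport_bmass_gt0.
Qed.

Lemma rweight_gt0 x (r : R) : S x -> (0 < r)%R -> (0 < rweight x r)%R.
Proof.
move=> [mx nx] r0; rewrite /rweight mulr_gt0//.
  by apply: prodr_gt0 => i _; rewrite powR_gt0// msupport_bmass_gt0//; exact: mx.
by rewrite powR_gt0// msupport_bmass_gt0.
Qed.

Lemma rweight_right_continuous x (r : R) : S x -> (0 < r)%R ->
  rweight x e @[e --> r^'+] --> rweight x r.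
Proof.
move=> [mx nx] r0.
have pw (lambda : probability (borelRd R d) R) (s : R) : msupport lambda x ->
    ((bmass lambda x e `^ s) @[e --> r^'+] --> bmass lambda x r `^ s)%R.
  move=> lx; have b0 := msupport_bmass_gt0 lx r0.
  have cs : {for bmass lambda x r, continuous (fun a : R => (a `^ s)%R)}.
    apply: differentiable_continuous; apply/derivable1_diffP.
    by apply: derivable_powR; rewrite in_itv/= b0.
  exact: (continuous_cvg _ cs (@bmass_right_continuous _ _ _ (fin lambda) x r)).
apply: cvgM; last exact: pw.
elim: (index_enum _) => [|i s IH].
  by rewrite big_nil; under eq_fun do rewrite big_nil; exact: cvg_cst.
rewrite big_cons; under eq_fun do rewrite big_cons.
by apply: cvgM => //; apply: pw; exact: mx.
Qed.

Lemma rweight_measurable (r : R) : measurable_fun setT (fun x : borelRd R d => rweight x r).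
Proof.
apply: measurable_funM.
  apply: measurable_prod => i _.
  by apply: (measurableT_comp (measurable_powR _)); exact: (bmass_measurable (fin _)).
by apply: (measurableT_comp (measurable_powR _)); exact: (bmass_measurable (fin _)).
Qed.

Section ratio.
Variable theta : {measure set (borelRd R d) -> \bar R}.
Hypothesis theta_fin : theta setT < +oo.

Definition mass_ratio x (r : R) : R := (bmass theta x r / rweight x r)%R.

Lemma ratioE x (r : R) : S x -> (0 < r)%R ->
  theta (ecball x r) / weight mu nu q t x r = (mass_ratio x r)%:E.
Proof.
move=> Sx r0; rewrite weightE// (bmassE theta_fin) /mass_ratio EFinM inver gt_eqF//.
exact: rweight_gt0.
Qed.

(** The quotient is right continuous in the radius, so an open condition on it
holds at some rational radius as soon as it holds at some radius. *)
Lemma ratio_rational x (r s : R) (U : set R) : S x -> (0 < r)%R -> (r < s)%R ->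
  open U -> U (mass_ratio x r) -> exists a : rat, (r < ratr a < s)%R /\ U (mass_ratio x (ratr a)).
Proof.
move=> Sx r0 rs oU Ur.
have cv : mass_ratio x e @[e --> r^'+] --> mass_ratio x r.
  apply: cvgM; first exact: bmass_right_continuous.
  apply: cvgV; first by rewrite gt_eqF// rweight_gt0.
  exact: rweight_right_continuous.
have : \forall e \near r^'+, U (mass_ratio x e) /\ (e < s)%R.
  near=> e; split; last by near: e; exact: nbhs_right_lt.
  by near: e; apply: cv; exact: open_nbhs_nbhs.
move=> /near_right_itv[e e0 eP].
have [a] := @rat_in_itvoo R r (r + e)%R ltac:(by rewrite ltrDl).
rewrite in_itv/= => ra; have [Ua as_] := eP _ ra.
by exists a; rewrite as_ (andP ra).1.
Unshelve. all: by end_near. Qed.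

Lemma ratio_measurable (r : R) : measurable_fun setT (fun x : borelRd R d => mass_ratio x r).
Proof.
have -> : (fun x : borelRd R d => mass_ratio x r) =
    (fun x => (bmass theta x r * rweight x r `^ (-1))%R).
  apply/funext => x; rewrite /mass_ratio powR_inv1// mulr_ge0 ?powR_ge0//.
  by apply: prodr_ge0 => i _; exact: powR_ge0.
apply: measurable_funM; first exact: bmass_measurable.
by apply: (measurableT_comp (measurable_powR _)); exact: rweight_measurable.
Qed.

Variable E : set (borelRd R d).
Hypotheses (mE : measurable E) (ES : E `<=` S).

(** Restricting to rational radii turns the existential into a countable union
of preimages of [U]. *)
Lemma ratio_exists_measurable (U : set R) (s : R) : open U ->
  measurable ([set x | E x /\ exists r, (0 < r < s)%R /\ U (mass_ratio x r)] : set (borelRd R d)).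
Proof.
move=> oU.
pose F (a : rat) : set (borelRd R d) :=
  if (0 < (ratr a : R) < s)%R then (fun x => mass_ratio x (ratr a)) @^-1` U else set0.
rewrite (_ : [set x | _] = E `&` \bigcup_a F a).
  apply: measurableI => //; apply: bigcupT_measurable_rat => a; rewrite /F.
  case: ifP => // _; rewrite -[X in measurable X]setTI.
  by apply: ratio_measurable => //; exact: open_measurable.
apply/seteqP; split => x [Ex].
  move=> [r [/andP[r0 rs] Ur]]; split => //.
  have [a [/andP[ra as_] Ua]] := ratio_rational (ES Ex) r0 rs oU Ur.
  by exists a => //; rewrite /F (lt_trans r0 ra) as_.
move=> [a _]; rewrite /F; case: ifP => // a0s Ua; split => //.
by exists (ratr a).
Qed.

Definition ratio_lower (c s : R) : set (borelRd R d) :=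
  [set x | E x /\ forall r, (0 < r < s)%R -> (c <= mass_ratio x r)%R].

Definition ratio_upper (c s : R) : set (borelRd R d) :=
  [set x | E x /\ forall r, (0 < r < s)%R -> (mass_ratio x r <= c)%R].

Definition ratio_often_above (c : R) : set (borelRd R d) :=
  [set x | E x /\ forall s, (0 < s)%R -> exists r, (0 < r < s)%R /\ (c < mass_ratio x r)%R].

Lemma ratio_lower_measurable c s : measurable (ratio_lower c s).
Proof.
rewrite (_ : ratio_lower c s =
    E `\` [set x | E x /\ exists r, (0 < r < s)%R /\ [set y | (y < c)%R] (mass_ratio x r)]).
  by apply: measurableD => //; apply: ratio_exists_measurable; exact: open_lt.
apply/seteqP; split => x [Ex xr]; split => //.
  by move=> [_ [r [/xr + rc]]]; rewrite leNgt => /negP; apply.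
by move=> r rs; rewrite leNgt; apply/negP => rc; apply: xr; split => //; exists r.
Qed.

Lemma ratio_upper_measurable c s : measurable (ratio_upper c s).
Proof.
rewrite (_ : ratio_upper c s =
    E `\` [set x | E x /\ exists r, (0 < r < s)%R /\ [set y | (c < y)%R] (mass_ratio x r)]).
  by apply: measurableD => //; apply: ratio_exists_measurable; exact: open_gt.
apply/seteqP; split => x [Ex xr]; split => //.
  by move=> [_ [r [/xr + rc]]]; rewrite leNgt => /negP; apply.
by move=> r rs; rewrite leNgt; apply/negP => rc; apply: xr; split => //; exists r.
Qed.

Lemma ratio_often_above_measurable c : measurable (ratio_often_above c).
Proof.
rewrite (_ : ratio_often_above c = \bigcap_n
    [set x | E x /\ exists r, (0 < r < n.+1%:R^-1)%R /\ [set y | (c < y)%R] (mass_ratio x r)]).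
  by apply: bigcapT_measurable => n; apply: ratio_exists_measurable; exact: open_gt.
apply/seteqP; split => x.
  by move=> [Ex xc] n _; split => //; apply: xc; rewrite invr_gt0.
move=> xc; split; first by have [] := xc 0%N I.
move=> s s0; have [_ [r [/andP[r0 rs] rc]]] := xc (Num.truncn (s^-1)%R) I.
exists r; split => //; rewrite r0/= (lt_trans rs)//.
by rewrite -[ltRHS]invrK ltf_pV2 ?posrE ?invr_gt0// truncnS_gt.
Qed.

End ratio.
End weights.

(** * Upper and lower densities *)

Lemma ereal_between (R : realType) (x y : \bar R) : (x < y)%E ->
  exists c : R, (x < c%:E < y)%E.
Proof.
case: x y => [x| |] [y| |]//.
- rewrite lte_fin => xy; exists ((x + y) / 2); rewrite !lte_fin; apply/andP; split; lra.
- by move=> _; exists (x + 1); rewrite lte_fin ltry andbT ltrDl.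
- by move=> _; exists (y - 1); rewrite lte_fin ltNyr/= gtrDl oppr_lt0.
- by move=> _; exists 0; rewrite ltNyr ltry.
Qed.

Section limsup_right.
Local Open Scope ereal_scope.
Context {R : realType}.
Variable f : R -> \bar R.

Lemma limf_esup_right_lt (c : \bar R) : limf_esup f 0^'+ < c ->
  exists2 s, (0 < s)%R & forall r, (0 < r < s)%R -> f r < c.
Proof.
move=> /ereal_inf_lt[_ [A /near_right_itv[s s0 sA] <-] Ac]; exists s => // r rs.
apply: le_lt_trans Ac; apply: ereal_sup_ubound; exists r => //; apply: sA.
by rewrite add0r.
Qed.

Lemma limf_esup_right_gt (c : \bar R) : c < limf_esup f 0^'+ ->
  forall s, (0 < s)%R -> exists r, (0 < r < s)%R /\ c < f r.
Proof.
move=> cf s s0; apply: contrapT => /forallNP nr.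
move: cf; rewrite ltNge => /negP; apply.
apply: (@le_trans _ _ (ereal_sup (f @` [set r | (0 < r < s)%R]))).
  apply: ereal_inf_lbound; exists [set r | (0 < r < s)%R] => //.
  by apply/near_right_itv; exists s => // y; rewrite add0r.
apply: ge_ereal_sup => _ [r rs <-]; rewrite leNgt; apply/negP => cr.
by apply: (nr r).
Qed.

End limsup_right.

Section liminf_right.
Local Open Scope ereal_scope.
Context {R : realType}.
Variable f : R -> \bar R.

Lemma limf_einf_right_gt (c : \bar R) : c < limf_einf f 0^'+ ->
  exists2 s, (0 < s)%R & forall r, (0 < r < s)%R -> c < f r.
Proof.
rewrite /limf_einf lteNr => /limf_esup_right_lt[s s0 sP]; exists s => // r rs.
by rewrite -lteN2; exact: sP.
Qed.

Lemma limf_einf_right_lt (c : \bar R) : limf_einf f 0^'+ < c ->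
  forall s, (0 < s)%R -> exists r, (0 < r < s)%R /\ f r < c.
Proof.
rewrite /limf_einf lteNl => /limf_esup_right_gt + s s0 => /(_ s s0)[r [rs rc]].
by exists r; split => //; rewrite -lteN2.
Qed.

Lemma limf_einf_le_esup_right : limf_einf f 0^'+ <= limf_esup f 0^'+.
Proof.
rewrite leNgt; apply/negP => /ereal_between[c /andP[/limf_esup_right_lt[s s0 sP] ci]].
have [s' s'0 s'P] := limf_einf_right_gt ci.
pose r := (Num.min s s' / 2)%R.
have m0 : (0 < Num.min s s')%R by rewrite lt_min s0.
have rm : (r < Num.min s s')%R by rewrite /r; lra.
move: rm; rewrite lt_min => /andP[rs rs'].
have r0 : (0 < r)%R by rewrite divr_gt0.
have fr : f r < c%:E by apply: sP; rewrite r0 rs.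
have cf : c%:E < f r by apply: s'P; rewrite r0 rs'.
by have := lt_trans cf fr; rewrite ltxx.
Qed.

End liminf_right.

Section density.
Local Open Scope ereal_scope.
Context {R : realType} {d k : nat}.
Variables (mu : 'I_k -> probability (borelRd R d) R)
          (nu : probability (borelRd R d) R) (q : 'I_k -> R) (t : R).
Local Notation S := (msupport_vec mu `&` msupport nu).
Variable theta : {measure set (borelRd R d) -> \bar R}.
Hypothesis theta_fin : theta setT < +oo.
Variables (E : set (borelRd R d)) (Phi : set 'rV[R]_d -> \bar R).
Hypotheses (ES : E `<=` S) (thetaE : forall B, theta B = Phi (E `&` B)).
Local Notation ratio := (mass_ratio mu nu q t theta).
Local Notation Dup := (upper_density mu nu q t (fun A => Phi (E `&` A))).
Local Notation Dlow := (lower_density mu nu q t (fun A => Phi (E `&` A))).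

Let fE x (r : R) : E x -> (0 < r)%R ->
  Phi (E `&` ecball x r) / weight mu nu q t x r = (ratio x r)%:E.
Proof. by move=> /ES Sx r0; rewrite -thetaE ratioE. Qed.

Lemma upper_density_lt x (c : R) : E x -> Dup x < c%:E ->
  exists2 s, (0 < s)%R & forall r, (0 < r < s)%R -> (ratio x r <= c)%R.
Proof.
move=> Ex /limf_esup_right_lt[s s0 sP]; exists s => // r rs.
by have := sP r rs; rewrite fE ?(andP rs).1// lte_fin => /ltW.
Qed.

Lemma upper_density_gt x (c : R) : E x -> c%:E < Dup x ->
  forall s, (0 < s)%R -> exists r, (0 < r < s)%R /\ (c < ratio x r)%R.
Proof.
move=> Ex /limf_esup_right_gt + s s0 => /(_ s s0)[r [rs rc]]; exists r; split => //.
by move: rc; rewrite fE ?(andP rs).1.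
Qed.

Lemma lower_density_gt x (c : R) : E x -> c%:E < Dlow x ->
  exists2 s, (0 < s)%R & forall r, (0 < r < s)%R -> (c <= ratio x r)%R.
Proof.
move=> Ex /limf_einf_right_gt[s s0 sP]; exists s => // r rs.
by have := sP r rs; rewrite fE ?(andP rs).1// lte_fin => /ltW.
Qed.

Lemma lower_density_lt x (c : R) : E x -> Dlow x < c%:E ->
  forall s, (0 < s)%R -> exists r, (0 < r < s)%R /\ (ratio x r < c)%R.
Proof.
move=> Ex /limf_einf_right_lt + s s0 => /(_ s s0)[r [rs rc]]; exists r; split => //.
by move: rc; rewrite fE ?(andP rs).1.
Qed.

Lemma lower_le_upper_density x : Dlow x <= Dup x.
Proof. exact: limf_einf_le_esup_right. Qed.

Lemma ratio_lowerP x (r c : R) : E x -> (0 < r)%R ->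
  (c <= ratio x r)%R = (c * rweight mu nu q t x r <= bmass theta x r)%R.
Proof. by move=> /ES Sx r0; rewrite /mass_ratio ler_pdivlMr// rweight_gt0. Qed.

Lemma ratio_upperP x (r c : R) : E x -> (0 < r)%R ->
  (ratio x r <= c)%R = (bmass theta x r <= c * rweight mu nu q t x r)%R.
Proof. by move=> /ES Sx r0; rewrite /mass_ratio ler_pdivrMr// rweight_gt0. Qed.

End density.

(** * Density theorems *)

Section ereal_scaling.
Local Open Scope ereal_scope.
Context {R : realType}.

Lemma esumZl_le (T : choiceType) (S : set T) (a : T -> \bar R) (c : R) :
  (0 <= c)%R -> (forall i, S i -> 0 <= a i) ->
  \esum_(i in S) (c%:E * a i) <= c%:E * \esum_(i in S) a i.
Proof.
move=> c0 a0; apply: ge_ereal_sup => _ [J [fJ JS] <-].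
rewrite fsbig_finite//= big_seq -ge0_sume_distrr; last first.
  by move=> i; rewrite in_fset_set// => /set_mem /JS; exact: a0.
apply: lee_wpmul2l => //; rewrite -big_seq -fsbig_finite//.
by apply: ereal_sup_ubound; exists J.
Qed.

Lemma esumZl (T : choiceType) (S : set T) (a : T -> \bar R) (c : R) :
  (0 < c)%R -> (forall i, S i -> 0 <= a i) ->
  \esum_(i in S) (c%:E * a i) = c%:E * \esum_(i in S) a i.
Proof.
move=> c0 a0; apply/eqP; rewrite eq_le (esumZl_le (ltW c0) a0)/=.
rewrite -lee_pdivlMl//.
rewrite [leLHS](_ : _ = \esum_(i in S) ((c^-1)%:E * (c%:E * a i))); last first.
  by apply: eq_esum => i _; rewrite muleA -EFinM mulVf ?gt_eqF// mul1e.
apply: esumZl_le; first by rewrite invr_ge0 ltW.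
by move=> i Si; rewrite mule_ge0 ?lee_fin ?a0// ltW.
Qed.

Lemma contraction_eq0 (x : \bar R) (c : R) : (c < 1)%R -> 0 <= x -> x < +oo ->
  x <= c%:E * x -> x = 0.
Proof.
case: x => [x| |]// c1; rewrite -EFinM !lee_fin => x0 _ xc; congr EFin.
by apply/eqP; rewrite eq_le x0 andbT; nra.
Qed.

End ereal_scaling.

Section density_theorems.
Local Open Scope ereal_scope.
Context {R : realType} {d k : nat}.
Variables (mu : 'I_k -> probability (borelRd R d) R)
          (nu : probability (borelRd R d) R) (q : 'I_k -> R) (t : R).
Variable E : set (borelRd R d).
Hypothesis ES : E `<=` msupport_vec mu `&` msupport nu.
Implicit Types A B F : set (borelRd R d).
Local Notation w := (weight mu nu q t).
Local Notation rw := (rweight mu nu q t).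
Local Notation Hdelta := (hausdorff_delta mu nu q t).
Local Notation Hpre := (hausdorff_pre mu nu q t).
Local Notation H := (hausdorff mu nu q t).
Local Notation Pdelta := (packing_delta mu nu q t).
Local Notation Ppre := (packing_pre mu nu q t).
Local Notation P := (packing mu nu q t).

Section one_measure.
Variable theta : {measure set (borelRd R d) -> \bar R}.
Hypothesis theta_fin : theta setT < +oo.
Local Notation bm := (bmass theta).

(** If null sets of [theta] are null for the Hausdorff measure, the part of [F]
missed by the Vitali family costs nothing. *)
Lemma hausdorff_delta_vitali (Q : 'rV[R]_d -> R -> Prop) F (delta : R) :
  (forall N, measurable N -> theta N = 0 -> H (E `&` N) = 0) ->
  F `<=` E -> fine_at Q F -> (0 < delta)%R ->
  exists S : set ('rV[R]_d * R), [/\ countable S,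
    forall p, S p -> [/\ F p.1, (0 < p.2 <= delta)%R & Q p.1 p.2],
    trivIset S pball & Hdelta delta F <= \esum_(p in S) w p.1 p.2].
Proof.
move=> nullH FE fQ d0.
have [|S [cS SP tS [N [mN FN N0]]]] :=
    @vitali_besicovitch R d theta theta_fin (fun x r => (r <= delta)%R /\ Q x r) F.
  move=> x Fx e e0; have [|r /andP[r0 re] Qr] := fQ x Fx (Num.min e delta)%R.
    by rewrite lt_min e0.
  by move: re; rewrite le_min => /andP[re rd]; exists r; rewrite ?r0.
exists S; split => //.
  by move=> p /SP[Fp p0 [pd Qp]]; split => //; rewrite p0.
rewrite -{1}(setUIDK F (pballs S)).
apply: (le_trans (hausdorff_deltaU _ _ _ _ _ _ _)); rewrite -[leRHS]adde0; apply: leeD.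
  apply: (@hausdorff_delta_le _ _ _ _ _ _ _ ('rV[R]_d * R)%type) => //.
    move=> p Sp; have [Fp p0 [pd _]] := SP p Sp; split; last by rewrite p0.
    by split => //; exists p => //; rewrite /pball; apply: ecball_center; exact: ltW.
apply: (le_trans (hausdorff_delta_le_pre _ _ _ _ _ d0)).
by rewrite -(nullH N mN N0); apply: hausdorff_pre_le => x [Fx nS]; split; [exact: FE|exact: FN].
Qed.

(** Every covering by small balls centred in [F] bounds [Phi F], by countable
subadditivity and the bound on each ball. *)
Lemma outer_le_hausdorff_pre (Phi : {outer_measure set 'rV[R]_d -> \bar R}) F (c s : R) :
  (forall B, theta B = Phi (E `&` B)) -> F `<=` E -> (0 < c)%R -> (0 < s)%R ->
  (forall x r, F x -> (0 < r < s)%R -> (bm x r <= c * rw x r)%R) ->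
  Phi F <= c%:E * Hpre F.
Proof.
move=> thetaE FE c0 s0 Fs.
rewrite -lee_pdivrMl//.
apply: (@le_trans _ _ (Hdelta (s / 2)%R F)); last first.
  by apply: hausdorff_delta_le_pre; rewrite divr_gt0.
apply: le_ereal_inf_tmp => _ [I [x [r [[Ix Icov] ->]]]].
rewrite lee_pdivrMl//.
apply: (@le_trans _ _ (\esum_(i in I) Phi (E `&` ecball (x i) (r i)))).
  apply: le_trans (@outer_measure_esum _ nat _ Phi _ _ (countableP _)).
  by apply: le_outer_measure => y Fy; have [i Ii yi] := Icov y Fy; exists i => //; split => //; exact: FE.
apply: (le_trans _ (esumZl_le _ _)); last 2 first.
- exact: ltW.
- by move=> i _; exact: weight_ge0.
apply: le_esum => i Ii; have [Fx /andP[r0 rs]] := Ix i Ii.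
rewrite -thetaE bmassE// (weightE _ _ (ES (FE _ Fx)) r0) -EFinM lee_fin.
by apply: Fs => //; rewrite r0/=; lra.
Qed.

(** The balls of a fine packing of [C] are disjoint and lie in a small
neighbourhood of [C]; as [C] is closed, the mass of these neighbourhoods
decreases to that of [C]. *)
Lemma packing_pre_closed_le C (c s : R) : closed (C : set 'rV[R]_d) -> C `<=` E ->
  (0 < c)%R -> (0 < s)%R ->
  (forall x r, C x -> (0 < r < s)%R -> (c * rw x r <= bm x r)%R) ->
  c%:E * Ppre C <= theta C.
Proof.
move=> cC CE c0 s0 Cs.
rewrite leNgt; apply/negP => tC.
pose O (n : nat) : set (borelRd R d) := [set y | exists2 x, C x & (edist x y < n.+1%:R^-1)%R].
have oO n : open (O n : set 'rV[R]_d).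
  apply/open_ecball => y [x Cx xy]; exists ((n.+1%:R^-1 - edist x y) / 2)%R.
    by rewrite divr_gt0// subr_gt0.
  move=> z; rewrite /ecball/= => yz; exists x => //.
  rewrite /=; move: (n.+1%:R^-1)%R xy yz => a xy yz.
  by have := edist_triangle y x z; lra.
have mO n : measurable (O n) by exact: open_measurable_borelRd.
have [||n nP] := @measure_bigcap_lt _ _ theta theta_fin O (c%:E * Ppre C) mO.
- move=> n m nm; apply/subsetPset => y [x Cx xy]; exists x => //.
  by rewrite (lt_le_trans xy)// lef_pV2 ?posrE// ler_nat.
- rewrite (_ : \bigcap_n _ = C)//; apply/seteqP; split => y.
    move=> yO; apply: contrapT => nCy.
    have [e e0 eC] := (open_ecball (~` C)).1 (closed_openC cC) y nCy.
    have [x Cx xy] := yO (Num.truncn (e^-1)%R) I.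
    apply: (eC x) => //; rewrite /ecball/= edistC ltW// (lt_trans xy)//.
    by rewrite -[ltRHS]invrK ltf_pV2 ?posrE ?invr_gt0// truncnS_gt.
  by move=> Cy n _; exists y => //; rewrite edistxx invr_gt0.
move: nP; apply/negP; rewrite -leNgt muleC -lee_pdivlMr//.
pose delta := (Num.min (n.+1%:R^-1) s / 2)%R.
have m0 : (0 < Num.min (n.+1%:R^-1) s :> R)%R by rewrite lt_min invr_gt0 ltr0n.
have d0 : (0 < delta)%R by rewrite divr_gt0.
have : (delta < Num.min (n.+1%:R^-1) s)%R by rewrite /delta; lra.
rewrite lt_min => /andP[dn ds].
apply: (le_trans (packing_pre_le_delta _ _ _ _ _ d0)).
apply: ge_ereal_sup => _ [I [x [r [[Ix It] ->]]]].
have key i : I i -> ecball (x i) (r i) `<=` O n.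
  move=> /Ix[Cx /andP[_ rd]] y; rewrite /ecball/= => xy; exists (x i) => //.
  by rewrite (le_lt_trans xy)// (le_lt_trans rd).
rewrite lee_pdivlMr// muleC -esumZl => [|//|i _]; last exact: weight_ge0.
apply: (@le_trans _ _ (\esum_(i in I) theta (ecball (x i) (r i)))).
  apply: le_esum => i Ii; have [Cx /andP[r0 rd]] := Ix i Ii.
  rewrite bmassE// (weightE _ _ (ES (CE _ Cx)) r0) -EFinM lee_fin.
  by apply: Cs => //; rewrite r0/= (le_lt_trans rd).
apply: (@esum_le_measure _ nat) => // i Ii; split; last exact: key.
exact: ecball_measurable.
Qed.

End one_measure.

Hypothesis mE : measurable E.

Lemma restriction_finite (Phi : set 'rV[R]_d -> \bar R)
  (theta : {measure set (borelRd R d) -> \bar R}) :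
  (forall B, theta B = Phi (E `&` B)) -> Phi E < +oo -> theta setT < +oo.
Proof. by move=> ->; rewrite setIT. Qed.

Lemma hausdorff_restriction : exists theta : {measure set (borelRd R d) -> \bar R},
  forall B, theta B = H (E `&` B).
Proof. exact: (outer_restriction_measure (@hausdorff_metric _ _ _ _ _ _ _) mE). Qed.

Lemma packing_restriction : exists theta : {measure set (borelRd R d) -> \bar R},
  forall B, theta B = P (E `&` B).
Proof. exact: (outer_restriction_measure (@packing_metric _ _ _ _ _ _ _) mE). Qed.

(** Borel sets reduce to closed sets by inner regularity of the packing
measure on [E]. *)
Lemma packing_le_lower (theta : {measure set (borelRd R d) -> \bar R}) A (c s : R) :
  theta setT < +oo -> P E < +oo -> measurable A -> A `<=` E -> (0 < c)%R -> (0 < s)%R ->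
  (forall x r, A x -> (0 < r < s)%R -> (c * rw x r <= bmass theta x r)%R) ->
  c%:E * P A <= theta A.
Proof.
move=> theta_fin PE mA AE c0 s0 As.
have [thetaP thetaPE] := packing_restriction.
apply/lee_addgt0Pr => e e0.
have [C [U [cC _ CA AU UC]]] := borel_regularity (restriction_finite thetaPE PE)
  mA (divr_gt0 e0 c0).
have mC : measurable C by exact: closed_measurable_borelRd.
have AC : P (A `\` C) <= (e / c)%:E.
  apply: le_trans UC; rewrite thetaPE; apply: le_packing => x [Ax nC].
  by split; [exact: AE|split => //; exact: AU].
apply: (@le_trans _ _ (c%:E * (P C + (e / c)%:E))).
  apply: lee_wpmul2l; first by rewrite lee_fin ltW.
  apply: (@le_trans _ _ (P C + P (A `\` C))); last by rewrite leeD2l.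
  apply: le_trans (outer_measureU2 _ _ _); apply: le_packing => x Ax.
  by have [Cx|nCx] := pselect (C x); [left|right].
rewrite ge0_muleDr; [|exact: packing_ge0|by rewrite lee_fin divr_ge0 ?ltW].
rewrite -EFinM mulrCA divff ?gt_eqF// mulr1 leeD2r//.
apply: (@le_trans _ _ (theta C)); last by apply: le_measure; rewrite ?inE.
apply: (@le_trans _ _ (c%:E * Ppre C)).
  by apply: lee_wpmul2l; [rewrite lee_fin ltW|exact: packing_le_pre].
apply: (packing_pre_closed_le theta_fin cC _ c0 s0) => [x /CA /AE//|x r /CA].
exact: As.
Qed.

(** Vitali balls carry all the packing measure of [A] on [E]. *)
Lemma packing_le_often_below (theta : {measure set (borelRd R d) -> \bar R}) A (c : R) :
  (forall B, theta B = P (E `&` B)) -> P E < +oo -> A `<=` E -> (0 < c)%R ->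
  (forall x s, A x -> (0 < s)%R -> exists r, (0 < r < s)%R /\ (bmass theta x r <= c * rw x r)%R) ->
  P A <= c%:E * Ppre A.
Proof.
move=> thetaE PE AE c0 Ac; have theta_fin := restriction_finite thetaE PE.
rewrite -lee_pdivrMl//; apply: le_ereal_inf_tmp => _ [delta /= d0 <-].
rewrite lee_pdivrMl//.
have [|S [cS SP tS [N [mN AN N0]]]] := @vitali_besicovitch R d theta theta_fin
    (fun x r => (r <= delta)%R /\ (bmass theta x r <= c * rw x r)%R) A.
  move=> x Ax e e0; have [|r [/andP[r0 re] Qr]] := Ac x (Num.min e delta)%R Ax.
    by rewrite lt_min e0.
  by move: re; rewrite lt_min => /andP[re rd]; exists r; [rewrite r0 ltW|split => //; exact: ltW].
apply: (@le_trans _ _ (P (E `&` N) + P (\bigcup_(p in S) (E `&` pball p)))).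
  apply: le_trans (outer_measureU2 _ _ _); apply: le_packing => x Ax.
  have [[p Sp px]|nS] := pselect (pballs S x).
    by right; exists p => //; split => //; exact: AE.
  by left; split; [exact: AE|exact: AN].
rewrite -thetaE N0 add0e.
apply: (le_trans (outer_measure_esum _ _ cS)).
apply: (@le_trans _ _ (\esum_(p in S) (c%:E * w p.1 p.2))).
  apply: le_esum => p Sp; have [Ap p0 [_ pc]] := SP p Sp.
  apply: (@le_trans _ _ (theta (pball p))); first by rewrite thetaE.
  by rewrite /pball bmassE// (weightE _ _ (ES (AE _ Ap)) p0) -EFinM lee_fin.
rewrite esumZl// => [|p _]; last exact: weight_ge0.
apply: lee_wpmul2l; first by rewrite lee_fin ltW.
apply: (@packing_delta_ge _ _ _ _ _ _ _ ('rV[R]_d * R)%type) => //.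
by move=> p Sp; have [Ap p0 [pd _]] := SP p Sp; rewrite p0.
Qed.

(** Summing [packing_le_often_below] over the traces on [A] of any cover of [A]
gives [P A <= c * P A]. *)
Lemma packing_often_below_null (theta : {measure set (borelRd R d) -> \bar R}) A (c : R) :
  (forall B, theta B = P (E `&` B)) -> P E < +oo -> A `<=` E -> (0 < c < 1)%R ->
  (forall x s, A x -> (0 < s)%R -> exists r, (0 < r < s)%R /\ (bmass theta x r <= c * rw x r)%R) ->
  P A = 0.
Proof.
move=> thetaE PE AE /andP[c0 c1] Ac.
apply: (contraction_eq0 c1 (packing_ge0 _ _ _ _ _)).
  by apply: le_lt_trans PE; exact: le_packing.
rewrite -lee_pdivrMl//; apply: le_ereal_inf_tmp => _ [C AC <-].
rewrite lee_pdivrMl// -nneseriesZl; last by move=> n _; exact: packing_pre_ge0.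
rewrite [in leLHS](_ : A = \bigcup_n (A `&` C n)); last first.
  by rewrite -setI_bigcupr; apply/esym/setIidPl.
apply: (le_trans (packing_sigma_subadditive _ _ _ _ _)).
apply: lee_nneseries => [n _ _|n _]; first exact: packing_ge0.
apply: (@le_trans _ _ (c%:E * Ppre (A `&` C n))).
  apply: (packing_le_often_below thetaE PE) => // [x [/AE//]|x s [Ax _]].
  exact: Ac.
by apply: lee_wpmul2l; [rewrite lee_fin ltW|apply: le_packing_pre; exact: subIsetr].
Qed.

(** Inside an open set of nearly the same mass as [A], disjoint balls of mass at
least [c] times their weight have total weight at most about
[c^-1 * theta A]. *)
Lemma hausdorff_often_above_null (theta : {measure set (borelRd R d) -> \bar R}) A (c : R) :
  (forall B, theta B = H (E `&` B)) -> H E < +oo -> measurable A -> A `<=` E -> (1 < c)%R ->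
  (forall x s, A x -> (0 < s)%R -> exists r, (0 < r < s)%R /\ (c * rw x r <= bmass theta x r)%R) ->
  H A = 0.
Proof.
move=> thetaE HE mA AE c1 Ac; have theta_fin := restriction_finite thetaE HE.
have c0 : (0 < c)%R by rewrite (lt_trans ltr01).
have HA : H A < +oo by apply: le_lt_trans HE; exact: le_hausdorff.
apply: (@contraction_eq0 _ _ c^-1%R) => //; [by rewrite invf_lt1|exact: hausdorff_ge0|].
have AthetaA : theta A = H A by rewrite thetaE setIC setIidl.
rewrite lee_pdivlMl//; apply/lee_addgt0Pr => e e0.
have [C [U [cC oU CA AU UC]]] := borel_regularity theta_fin mA e0.
have mU : measurable U by exact: open_measurable_borelRd.
have mC : measurable C by exact: closed_measurable_borelRd.
have tU : theta U <= H A + e%:E.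
  rewrite -(setUIDK U C) (le_trans (measureU2 _ _ _))//; [exact: measurableI|exact: measurableD|].
  by rewrite leeD// -AthetaA le_measure ?inE//; [exact: measurableI|move=> x [_ /CA]].
apply: le_trans tU.
rewrite -lee_pdivlMl//; apply: ge_ereal_sup => _ [F FA <-].
apply: ge_ereal_sup => _ [delta /= d0 <-].
have [||||S [cS SP tS Hle]] := @hausdorff_delta_vitali theta theta_fin
   (fun x r => ecball x r `<=` U /\ (c * rw x r <= bmass theta x r)%R) F delta.
- by move=> N mN; rewrite thetaE.
- exact: subset_trans AE.
- move=> x /FA Ax s s0; have [u u0 uU] := (open_ecball U).1 oU x (AU _ Ax).
  have [|r [/andP[r0 re] Qr]] := Ac x (Num.min s u)%R Ax; first by rewrite lt_min s0.
  move: re; rewrite lt_min => /andP[re ru]; exists r; first by rewrite r0 ltW.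
  by split => //; apply: subset_trans uU; apply: le_ecball; exact: ltW.
- exact: d0.
apply: (le_trans Hle); rewrite lee_pdivlMl// -esumZl// => [|p _]; last exact: weight_ge0.
apply: (@le_trans _ _ (\esum_(p in S) theta (pball p))).
  apply: le_esum => p Sp; have [/FA Ap /andP[p0 _] [_ pc]] := SP p Sp.
  by rewrite /pball bmassE// (weightE _ _ (ES (AE _ Ap)) p0) -EFinM lee_fin.
apply: esum_le_measure => // p Sp; split; first exact: ecball_measurable.
by have [_ _ []] := SP p Sp.
Qed.

(** A Vitali family for the packing measure on [E] is a packing, and a covering
up to a set that is null for the packing and thus for the Hausdorff measure. *)
Lemma hausdorff_le_packing A : P E < +oo -> A `<=` E -> H A <= P A.
Proof.
move=> PE AE; have [theta thetaE] := packing_restriction.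
have theta_fin := restriction_finite thetaE PE.
have pre F : F `<=` E -> Hpre F <= Ppre F.
  move=> FE; apply: ge_ereal_sup => _ [e /= e0 <-].
  apply: le_ereal_inf_tmp => _ [e' /= e'0 <-].
  pose delta := Num.min e e'.
  have d0 : (0 < delta)%R by rewrite lt_min e0.
  apply: (@le_trans _ _ (Hdelta delta F)); first by apply: le_hausdorff_delta; rewrite ge_min lexx.
  have [||||S [cS SP tS Hle]] := @hausdorff_delta_vitali theta theta_fin (fun _ _ => True) F delta.
  - by move=> N mN; rewrite thetaE; exact: packing_null_hausdorff_null.
  - exact: FE.
  - by move=> x Fx s s0; exists s => //; rewrite s0 lexx.
  - exact: d0.
  apply: (le_trans Hle); apply: (@le_trans _ _ (Pdelta delta F)).
    apply: (@packing_delta_ge _ _ _ _ _ _ _ ('rV[R]_d * R)%type) => //.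
    by move=> p /SP[].
  by apply: le_packing_delta => //; rewrite ge_min lexx orbT.
apply: ge_ereal_sup => _ [F FA <-]; apply: le_ereal_inf_tmp => _ [C AC <-].
rewrite (_ : F = \bigcup_n (F `&` C n)); last first.
  by rewrite -setI_bigcupr; apply/esym/setIidPl/(subset_trans FA).
apply: (le_trans (hausdorff_pre_subadditive _ _ _ _ _)).
apply: lee_nneseries => [n _ _|n _]; first exact: hausdorff_pre_ge0.
apply: (@le_trans _ _ (Ppre (F `&` C n))); first by apply: pre => x [/FA /AE].
by apply: le_packing_pre; exact: subIsetr.
Qed.

End density_theorems.

(** * Dimensions *)

Section dimension.
Local Open Scope ereal_scope.
Context {R : realType} {d k : nat}.
Hypothesis d_gt0 : (0 < d)%N.
Variables (mu : 'I_k -> probability (borelRd R d) R)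
          (nu : probability (borelRd R d) R) (q : 'I_k -> R).
Variables (alpha : R) (alpha_gt0 : (0 < alpha)%R) (nu_qa : quasi_ahlfors nu alpha).
Variable E : set 'rV[R]_d.
Hypothesis ES : E `<=` msupport_vec mu `&` msupport nu.
Implicit Types A F : set 'rV[R]_d.

Lemma critical_exponent_eq (f : R -> \bar R) (t : R) :
  (forall u, (u < t)%R -> f u = +oo) -> (forall u, (t < u)%R -> f u = 0) ->
  critical_exponent f = t%:E.
Proof.
move=> flt fgt; apply: xget_unique.
  by split => u; rewrite lte_fin; [exact: flt|exact: fgt].
move=> s [slt sgt]; apply/eqP; rewrite eq_le; apply/andP; split; rewrite leNgt;
  apply/negP => /ereal_between[c /andP[]]; rewrite lte_fin.
- by move=> /fgt fc0 /slt; rewrite fc0.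
- by move=> /sgt fc0 /flt; rewrite fc0.
Qed.

Lemma ediam_ecball (x : 'rV[R]_d) (r : R) : (0 < r)%R ->
  0 < ediam (ecball x r) /\ ediam (ecball x r) <= (2 * r)%:E.
Proof.
move=> r0; split.
  (* moving the centre by [r] along a coordinate axis *)
  pose j : 'I_d := Ordinal d_gt0.
  pose y : 'rV[R]_d := (x + r *: delta_mx 0%R j)%R.
  have e1 : enorm (delta_mx 0%R j : 'rV[R]_d) = 1%R.
    rewrite /enorm (bigD1 j)//= big1 => [|i ij]; first by rewrite !mxE !eqxx expr1n addr0 sqrtr1.
    by rewrite !mxE (negbTE ij) andbF expr0n.
  have xy : edist x y = r.
    by rewrite edistC edistE /y addrC addKr enormZ e1 mulr1 gtr0_norm.
  apply: (@lt_le_trans _ _ r%:E); first by rewrite lte_fin.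
  apply: ereal_sup_ubound; exists (x, y) => /=; last by rewrite xy.
  by split; rewrite /ecball/= ?edistxx ?xy// ltW.
apply: ge_ereal_sup => _ [[y z] [/= xy xz] <-].
move: xy xz; rewrite /ecball/= lee_fin => xy xz.
by have := edist_triangle x y z; rewrite (edistC y x); lra.
Qed.

(** The mass of small balls tends to zero uniformly in the centre. *)
Lemma quasi_ahlfors_ball (eta : R) : (0 < eta)%R -> exists2 s, (0 < s)%R &
  forall x r, (0 < r <= s)%R -> (bmass nu x r <= eta)%R.
Proof.
move=> eta0; have [M [delta [M0 [d0 nuM]]]] := nu_qa.
pose b := ((eta / M) `^ alpha^-1)%R.
have b0 : (0 < b)%R by rewrite powR_gt0 ?divr_gt0.
(* the diameter is at most [2 * r], which has to stay below [delta] and [b] *)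
exists (Num.min (delta / 3) (b / 2))%R; first by rewrite lt_min !divr_gt0.
move=> x r /andP[r0]; rewrite le_min => /andP[rd rb].
have [D0 Dr] := ediam_ecball x r0.
have Ddelta : ediam (ecball x r) < delta%:E by rewrite (le_lt_trans Dr)// lte_fin; lra.
have := nuM _ (ecball_measurable x r) D0 Ddelta.
have nufin : nu setT < +oo by rewrite probability_setT ltry.
rewrite -lee_fin -(bmassE nufin) => /le_trans; apply.
have Dfin : ediam (ecball x r) \is a fin_num.
  by rewrite ge0_fin_numE; [exact: lt_trans Ddelta (ltry _)|exact: ltW].
move: D0 Dr; rewrite -(fineK Dfin) poweR_EFin -EFinM !lee_fin lte_fin.
move: (fine _) => D D0 Dr; rewrite mulrC -ler_pdivlMr//.
have bE : (b `^ alpha = eta / M)%R.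
  by rewrite -powRrM mulVf ?gt_eqF// powRr1// divr_ge0// ltW.
rewrite -bE; apply: ge0_ler_powR; [exact: ltW|by rewrite nnegrE ltW|by rewrite nnegrE ltW|lra].
Qed.

Lemma rweight_shift (s u : R) (x : 'rV[R]_d) (r : R) :
  msupport nu x -> (0 < r)%R ->
  rweight mu nu q u x r = (bmass nu x r `^ (u - s) * rweight mu nu q s x r)%R.
Proof.
move=> nx r0; have b0 : (bmass nu x r != 0)%R by rewrite gt_eqF// msupport_bmass_gt0.
by rewrite /rweight mulrCA -powRD ?subrK// b0 implybT.
Qed.

(** The weights differ by the factor [nu (B(x,r)) `^ (u - s)]. *)
Lemma weight_le_scaled (s u eta : R) : (s < u)%R -> (0 < eta)%R ->
  exists2 delta, (0 < delta)%R & forall x r, E x -> (0 < r <= delta)%R ->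
    weight mu nu q u x r <= eta%:E * weight mu nu q s x r.
Proof.
move=> su eta0; have us : (0 < u - s)%R by rewrite subr_gt0.
have [|delta d0 dP] := @quasi_ahlfors_ball (eta `^ (u - s)^-1)%R; first by rewrite powR_gt0.
exists delta => // x r Ex rd; have r0 := (andP rd).1.
have [mx nx] := ES Ex.
rewrite !weightE//; try exact: ES.
rewrite -EFinM lee_fin (@rweight_shift s u)//; apply: ler_wpM2r.
  by apply/ltW/rweight_gt0 => //; exact: ES.
have -> : eta = ((eta `^ (u - s)^-1) `^ (u - s))%R.
  by rewrite -powRrM mulVf ?gt_eqF// powRr1// ltW.
apply: ge0_ler_powR; [exact: ltW| |by rewrite nnegrE powR_ge0|exact: dP].
have nufin : nu setT < +oo by rewrite probability_setT ltry.
by rewrite nnegrE; apply: bmass_ge0 nufin _ _.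
Qed.

Lemma hausdorff_le_scaled (s u eta : R) A : (s < u)%R -> (0 < eta)%R -> A `<=` E ->
  hausdorff mu nu q u A <= eta%:E * hausdorff mu nu q s A.
Proof.
move=> su eta0 AE; have [delta d0 wle] := weight_le_scaled su eta0.
apply: ge_ereal_sup => _ [F FA <-]; apply: ge_ereal_sup => _ [e /= e0 <-].
have m0 : (0 < Num.min e delta)%R by rewrite lt_min e0.
apply: (@le_trans _ _ (eta%:E * hausdorff_delta mu nu q s (Num.min e delta) F)); last first.
  apply: lee_wpmul2l; first by rewrite lee_fin ltW.
  exact: le_trans (hausdorff_delta_le_pre _ _ _ _ _ m0) (hausdorff_pre_le _ _ _ _ FA).
rewrite -lee_pdivrMl//; apply: le_ereal_inf_tmp => _ [I [x [r [[Ix Icov] ->]]]].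
rewrite lee_pdivrMl// -esumZl => [|//|i _]; last exact: weight_ge0.
apply: (@le_trans _ _ (\esum_(i in I) weight mu nu q u (x i) (r i))).
  apply: ereal_inf_lbound; exists I, x, r; split => //; split => //.
  move=> i /Ix[Fx /andP[r0 rm]]; split => //; rewrite r0/=.
  by move: rm; rewrite le_min => /andP[].
apply: le_esum => i /Ix[Fx /andP[r0]]; rewrite le_min => /andP[_ rd].
by apply: wle; [exact/AE/FA|rewrite r0].
Qed.

Lemma packing_le_scaled (s u eta : R) A : (s < u)%R -> (0 < eta)%R -> A `<=` E ->
  packing mu nu q u A <= eta%:E * packing mu nu q s A.
Proof.
move=> su eta0 AE; have [delta d0 wle] := weight_le_scaled su eta0.
have pre F : F `<=` E -> packing_pre mu nu q u F <= eta%:E * packing_pre mu nu q s F.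
  move=> FE; rewrite -lee_pdivrMl//; apply: le_ereal_inf_tmp => _ [e /= e0 <-].
  rewrite lee_pdivrMl//.
  have m0 : (0 < Num.min e delta)%R by rewrite lt_min e0.
  apply: (le_trans (packing_pre_le_delta _ _ _ _ _ m0)).
  apply: ge_ereal_sup => _ [I [x [r [[Ix It] ->]]]].
  apply: (@le_trans _ _ (\esum_(i in I) (eta%:E * weight mu nu q s (x i) (r i)))).
    apply: le_esum => i /Ix[Fx /andP[r0]]; rewrite le_min => /andP[_ rd].
    by apply: wle; [exact/FE|rewrite r0].
  rewrite esumZl => [|//|i _]; last exact: weight_ge0.
  apply: lee_wpmul2l; first by rewrite lee_fin ltW.
  apply: ereal_sup_ubound; exists I, x, r; split => //; split => //.
  move=> i /Ix[Fx /andP[r0 rm]]; split => //; rewrite r0/=.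
  by move: rm; rewrite le_min => /andP[].
rewrite -lee_pdivrMl//; apply: le_ereal_inf_tmp => _ [C AC <-].
rewrite lee_pdivrMl// -nneseriesZl; last by move=> n _; exact: packing_pre_ge0.
apply: (le_trans (@packing_le_sum _ _ _ _ _ _ _ _ (fun n => A `&` C n) _)).
  by rewrite -setI_bigcupr subsetI; split.
apply: lee_nneseries => [n _ _|n _]; first exact: packing_pre_ge0.
apply: (le_trans (pre _ _)); first by move=> x [/AE].
by apply: lee_wpmul2l; [rewrite lee_fin ltW|apply: le_packing_pre; exact: subIsetr].
Qed.

Lemma arbitrarily_small_eq0 (x y : \bar R) : 0 <= x -> y < +oo ->
  (forall eta : R, (0 < eta)%R -> x <= eta%:E * y) -> x = 0.
Proof.
move=> x0 yoo xy; apply/eqP; rewrite eq_le x0 andbT; apply/lee_addgt0Pr => e e0.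
have y0 : 0 <= y by have := le_trans x0 (xy _ ltr01); rewrite mul1e.
have yfin : y \is a fin_num by rewrite ge0_fin_numE.
rewrite add0e; have y1 : (0 < fine y + 1)%R by rewrite ltr_wpDl// fine_ge0.
apply: (le_trans (xy (e / (fine y + 1))%R _)); first by rewrite divr_gt0.
rewrite -(fineK yfin) -EFinM lee_fin/= mulrAC ler_pdivrMr// ler_pM2l//.
by rewrite lerDl.
Qed.

Lemma dimension_eq (Phi : R -> \bar R) (t : R) : (forall u, 0 <= Phi u) ->
  (forall s u eta, (s < u)%R -> (0 < eta)%R -> Phi u <= eta%:E * Phi s) ->
  0 < Phi t -> Phi t < +oo -> critical_exponent Phi = t%:E.
Proof.
move=> Phi0 sc t0 too; apply: critical_exponent_eq => u ut.
  apply/eqP; rewrite -leye_eq leNgt; apply/negP => uoo.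
  have := arbitrarily_small_eq0 (Phi0 t) uoo (fun eta => sc u t eta ut).
  by move=> tE; rewrite tE ltxx in t0.
exact: arbitrarily_small_eq0 (Phi0 u) too (fun eta => sc t u eta ut).
Qed.

Lemma hausdorff_dim_eq (t : R) A : A `<=` E ->
  0 < hausdorff mu nu q t A -> hausdorff mu nu q t A < +oo ->
  hausdorff_dim mu nu q A = t%:E.
Proof.
move=> AE; apply: dimension_eq => [u|s u eta su eta0]; first exact: hausdorff_ge0.
exact: hausdorff_le_scaled.
Qed.

Lemma packing_dim_eq (t : R) A : A `<=` E ->
  0 < packing mu nu q t A -> packing mu nu q t A < +oo ->
  packing_dim mu nu q A = t%:E.
Proof.
move=> AE; apply: dimension_eq => [u|s u eta su eta0]; first exact: packing_ge0.
exact: packing_le_scaled.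
Qed.

End dimension.

(** * Densities at almost every point *)

Section almost_everywhere.
Local Open Scope ereal_scope.
Context {R : realType} {d k : nat}.
Variables (mu : 'I_k -> probability (borelRd R d) R)
          (nu : probability (borelRd R d) R) (q : 'I_k -> R) (t : R).
Variable E : set (borelRd R d).
Hypothesis ES : E `<=` msupport_vec mu `&` msupport nu.
Hypothesis mE : measurable E.
Local Notation H := (hausdorff mu nu q t).
Local Notation P := (packing mu nu q t).
Local Notation Hup := (hausdorff_upper_density mu nu q t E).
Local Notation Hlow := (hausdorff_lower_density mu nu q t E).
Local Notation Pup := (packing_upper_density mu nu q t E).
Local Notation Plow := (packing_lower_density mu nu q t E).

Lemma outer_null_bigcup (Phi : {outer_measure set 'rV[R]_d -> \bar R})
  (A : set 'rV[R]_d) (C : nat -> set 'rV[R]_d) :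
  A `<=` \bigcup_n C n -> (forall n, Phi (C n) = 0) -> Phi A = 0.
Proof.
move=> AC C0; apply/eqP; rewrite eq_le outer_measure_ge0 andbT.
apply: (le_trans (le_outer_measure Phi _ _ AC)).
apply: (le_trans (outer_measure_sigma_subadditive _ _)).
by rewrite eseries0.
Qed.

Lemma outer_nullU (Phi : {outer_measure set 'rV[R]_d -> \bar R})
  (A B C : set 'rV[R]_d) :
  A `<=` B `|` C -> Phi B = 0 -> Phi C = 0 -> Phi A = 0.
Proof.
move=> ABC B0 C0; apply/eqP; rewrite eq_le outer_measure_ge0 andbT.
apply: (le_trans (le_outer_measure Phi _ _ ABC)).
by apply: (le_trans (outer_measureU2 _ _ _)); rewrite B0 C0 adde0.
Qed.

(** Thresholds tending to 1 from below and from above; the shift by 2 keeps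
[lo] positive, so that it can serve as a factor. *)
Definition lo (n : nat) : R := (1 - n.+2%:R^-1)%R.
Definition hi (n : nat) : R := (1 + n.+1%:R^-1)%R.

Lemma lo_bounds n : (0 < lo n < 1)%R.
Proof.
by rewrite /lo subr_gt0 invf_lt1 ?ltr1n//= gtrDl oppr_lt0 invr_gt0.
Qed.

Lemma hi_gt1 n : (1 < hi n)%R.
Proof. by rewrite /hi ltrDl invr_gt0 ltr0n. Qed.

Lemma inv_lt_pos (e : R) : (0 < e)%R -> exists n, (n.+1%:R^-1 < e)%R.
Proof.
move=> e0; exists (Num.truncn (e^-1)%R).
by rewrite -[ltRHS]invrK ltf_pV2 ?posrE ?invr_gt0// truncnS_gt.
Qed.

Lemma lt_lo (c : R) : (c < 1)%R -> exists n, (c < lo n)%R.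
Proof.
rewrite -subr_gt0 => /inv_lt_pos[n nc]; exists n; rewrite /lo.
rewrite ltrBrDr addrC -ltrBrDr; apply: le_lt_trans nc.
by rewrite lef_pV2 ?posrE// ler_nat.
Qed.

Lemma gt_hi (c : R) : (1 < c)%R -> exists n, (hi n < c)%R.
Proof.
by rewrite -subr_gt0 => /inv_lt_pos[n nc]; exists n; rewrite /hi addrC -ltrBrDr.
Qed.

Lemma hausdorff_upper_gt1_cover (theta : {measure set (borelRd R d) -> \bar R}) :
  (forall B, theta B = H (E `&` B)) -> theta setT < +oo ->
  [set x | E x /\ 1 < Hup x] `<=` \bigcup_n ratio_often_above mu nu q t theta E (hi n).
Proof.
move=> thetaE theta_fin x [Ex /ereal_between[c /andP[]]]; rewrite lte_fin => c1 cx.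
have [n nc] := gt_hi c1; exists n => //; split => // s s0.
have [r [rs rc]] := upper_density_gt theta_fin ES thetaE Ex cx s0.
by exists r; split => //; exact: lt_trans rc.
Qed.

Lemma hausdorff_often_above_hi_null (theta : {measure set (borelRd R d) -> \bar R}) n :
  (forall B, theta B = H (E `&` B)) -> H E < +oo ->
  H (ratio_often_above mu nu q t theta E (hi n)) = 0.
Proof.
move=> thetaE HE; have theta_fin := restriction_finite thetaE HE.
apply: (hausdorff_often_above_null ES thetaE HE _ _ (hi_gt1 n)).
- exact: ratio_often_above_measurable.
- by move=> x [].
- move=> x s [Ex xs] s0; have [r [rs rc]] := xs s s0; exists r; split => //.
  by rewrite -(ratio_lowerP _ _ _ ES) ?(andP rs).1// ltW.
Qed.

(** The exceptional set is a countable union of sets on which the Hausdorff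
measure is bounded by a proper fraction of itself. *)
Lemma hausdorff_upper_density_eq1 : H E < +oo ->
  H [set x | E x /\ ~ (Hup x = 1)] = 0.
Proof.
move=> HE; have [theta thetaE] := hausdorff_restriction mu nu q t mE.
have theta_fin := restriction_finite thetaE HE.
apply: (@outer_nullU _ _ [set x | E x /\ 1 < Hup x] [set x | E x /\ Hup x < 1]).
- move=> x [Ex /eqP]; rewrite neq_lt => /orP[xlt|xgt]; [right|left] => //.
- apply: (@outer_null_bigcup _ _ _ (hausdorff_upper_gt1_cover thetaE theta_fin)) => n.
  exact: hausdorff_often_above_hi_null.
pose C n := \bigcup_m ratio_upper mu nu q t theta E (lo n) (m.+1%:R^-1)%R.
apply: (@outer_null_bigcup _ _ C).
  move=> x [Ex /ereal_between[c /andP[xc]]]; rewrite lte_fin => c1.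
  have [n nc] := lt_lo c1; exists n => //.
  have [s s0 sP] := upper_density_lt theta_fin ES thetaE Ex xc.
  have [m ms] := inv_lt_pos s0; exists m => //; split => // r /andP[r0 rm].
  by rewrite (le_trans (sP r _))// ?r0 ?(lt_trans rm)// ltW.
move=> n; apply: (@outer_null_bigcup _ _ _ (@subset_refl _ _)) => m.
have /andP[l0 l1] := lo_bounds n.
apply: (contraction_eq0 l1 (hausdorff_ge0 _ _ _ _ _)).
  by apply: le_lt_trans HE; apply: le_hausdorff => x [].
apply: le_trans (lee_wpmul2l _ (@hausdorff_pre_le _ _ _ mu nu q t _ _ (@subset_refl _ _))); last first.
  by rewrite lee_fin ltW.
apply: (outer_le_hausdorff_pre (s := (m.+1%:R^-1)%R) ES theta_fin thetaE _ l0).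
- by move=> x [].
- by rewrite invr_gt0 ltr0n.
- move=> x r [Ex xr] rm; rewrite -(ratio_upperP _ _ _ ES) ?(andP rm).1//.
  exact: xr.
Qed.

Lemma packing_lower_lt1_null : P E < +oo -> P [set x | E x /\ Plow x < 1] = 0.
Proof.
move=> PE; have [theta thetaE] := packing_restriction mu nu q t mE.
have theta_fin := restriction_finite thetaE PE.
apply: (@outer_null_bigcup _ _
    (fun n => [set x | E x /\ forall s, (0 < s)%R -> exists r, (0 < r < s)%R /\
      (mass_ratio mu nu q t theta x r <= lo n)%R])).
  move=> x [Ex /ereal_between[c /andP[xc]]]; rewrite lte_fin => c1.
  have [n nc] := lt_lo c1; exists n => //; split => // s s0.
  have [r [rs rc]] := lower_density_lt theta_fin ES thetaE Ex xc s0.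
  by exists r; split => //; rewrite ltW// (lt_trans rc).
move=> n; apply: (packing_often_below_null ES thetaE PE _ (lo_bounds n)).
  by move=> x [].
move=> x s [Ex xs] s0; have [r [rs rc]] := xs s s0; exists r; split => //.
by rewrite -(ratio_upperP _ _ _ ES) ?(andP rs).1.
Qed.

Lemma packing_lower_gt1_null : P E < +oo -> P [set x | E x /\ 1 < Plow x] = 0.
Proof.
move=> PE; have [theta thetaE] := packing_restriction mu nu q t mE.
have theta_fin := restriction_finite thetaE PE.
pose C n := \bigcup_m ratio_lower mu nu q t theta E (hi n) (m.+1%:R^-1)%R.
apply: (@outer_null_bigcup _ _ C).
  move=> x [Ex /ereal_between[c /andP[]]]; rewrite lte_fin => c1 xc.
  have [n nc] := gt_hi c1; exists n => //.
  have [s s0 sP] := lower_density_gt theta_fin ES thetaE Ex xc.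
  have [m ms] := inv_lt_pos s0; exists m => //; split => // r /andP[r0 rm].
  by rewrite (le_trans _ (sP r _))// ?r0 ?(lt_trans rm)// ltW.
move=> n; apply: (@outer_null_bigcup _ _ _ (@subset_refl _ _)) => m.
have h1 := hi_gt1 n; have h0 : (0 < hi n)%R by rewrite (lt_trans ltr01).
have AE : ratio_lower mu nu q t theta E (hi n) (m.+1%:R^-1)%R `<=` E by move=> x [].
apply: (@contraction_eq0 _ _ (hi n)^-1%R); [by rewrite invf_lt1|exact: packing_ge0| |].
  by apply: le_lt_trans PE; exact: le_packing.
rewrite lee_pdivlMl//.
apply: (@le_trans _ _ (theta (ratio_lower mu nu q t theta E (hi n) (m.+1%:R^-1)%R))).
  apply: (packing_le_lower ES mE theta_fin PE _ AE h0 (_ : 0 < m.+1%:R^-1)%R).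
  - exact: ratio_lower_measurable.
  - by rewrite invr_gt0 ltr0n.
  - move=> x r [Ex xr] rm; rewrite -(ratio_lowerP _ _ _ ES) ?(andP rm).1//.
    exact: xr.
by rewrite thetaE; apply: le_packing => x [].
Qed.

Lemma packing_lower_density_eq1 : P E < +oo ->
  P [set x | E x /\ ~ (Plow x = 1)] = 0.
Proof.
move=> PE.
apply: (@outer_nullU _ _ [set x | E x /\ Plow x < 1] [set x | E x /\ 1 < Plow x]).
- by move=> x [Ex /eqP]; rewrite neq_lt => /orP[xlt|xgt]; [left|right].
- exact: packing_lower_lt1_null.
- exact: packing_lower_gt1_null.
Qed.

Lemma null_compl_pos (Phi : {outer_measure set 'rV[R]_d -> \bar R}) (Q : 'rV[R]_d -> Prop) :
  0 < Phi E -> Phi [set x | E x /\ ~ Q x] = 0 -> 0 < Phi [set x | E x /\ Q x].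
Proof.
move=> E0 N0; apply: (lt_le_trans E0).
apply: (@le_trans _ _ (Phi ([set x | E x /\ Q x] `|` [set x | E x /\ ~ Q x]))).
  by apply: le_outer_measure => x Ex; have [Qx|nQx] := pselect (Q x); [left|right].
by apply: (le_trans (outer_measureU2 _ _ _)); rewrite N0 adde0.
Qed.

End almost_everywhere.

(** * Equality of the two measures *)

Section equality.
Local Open Scope ereal_scope.
Context {R : realType} {d k : nat}.
Variables (mu : 'I_k -> probability (borelRd R d) R)
          (nu : probability (borelRd R d) R) (q : 'I_k -> R) (t : R).
Variable E : set (borelRd R d).
Hypothesis ES : E `<=` msupport_vec mu `&` msupport nu.
Hypothesis mE : measurable E.
Local Notation H := (hausdorff mu nu q t).
Local Notation P := (packing mu nu q t).
Local Notation Hup := (hausdorff_upper_density mu nu q t E).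
Local Notation Hlow := (hausdorff_lower_density mu nu q t E).
Local Notation Pup := (packing_upper_density mu nu q t E).
Local Notation Plow := (packing_lower_density mu nu q t E).
Hypothesis PE : P E < +oo.

(** The packing measure on [E] is continuous along increasing Borel sets. *)
Lemma packing_le_exhaust (F : set (borelRd R d)) (G : nat -> set (borelRd R d)) (c : R) :
  measurable F -> F `<=` E -> (forall m, measurable (G m)) -> nondecreasing_seq G ->
  P (F `\` \bigcup_m G m) = 0 -> (0 < c)%R ->
  (forall m, c%:E * P (F `&` G m) <= H F) -> c%:E * P F <= H F.
Proof.
move=> mF FE mG ndG FG0 c0 cP.
have [theta thetaE] := packing_restriction mu nu q t mE.
rewrite -lee_pdivlMl// leNgt; apply/negP => FP.
have mFG m : measurable (F `&` G m) by exact: measurableI.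
have ndFG : nondecreasing_seq (fun m => F `&` G m).
  move=> m n mn; apply/subsetPset => x [Fx Gx]; split => //.
  exact: (subsetPset _ _ (ndG _ _ mn)).
have FGlt : (c^-1)%:E * H F < theta (\bigcup_m (F `&` G m)).
  apply: (lt_le_trans FP); rewrite thetaE.
  apply: (@le_trans _ _ (P (E `&` \bigcup_m (F `&` G m)) + P (F `\` \bigcup_m G m))).
    apply: le_trans (outer_measureU2 _ _ _); apply: le_packing => x Fx.
    have [[m _ Gx]|nG] := pselect ((\bigcup_m G m) x); last by right.
    by left; split; [exact: FE|exists m].
  by rewrite FG0 adde0.
have [m] := measure_bigcup_gt mFG ndFG FGlt.
apply/negP; rewrite -leNgt thetaE lee_pdivlMl//; apply: le_trans (cP m).
apply: lee_wpmul2l; first by rewrite lee_fin ltW.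
by apply: le_packing => x [].
Qed.

Lemma le_of_lo_le (x y : \bar R) : x < +oo -> 0 <= y ->
  (forall n, (lo n)%:E * x <= y) -> x <= y.
Proof.
case: x y => [x| |] [y| |]//= _; rewrite ?leey ?leNye// lee_fin => y0 xy.
rewrite lee_fin leNgt; apply/negP => yx; have x0 : (0 < x)%R by exact: le_lt_trans yx.
have [|n] := @lt_lo R (y / x)%R; first by rewrite ltr_pdivrMr// mul1r.
by rewrite ltr_pdivrMr// ltNge => /negP; apply; have := xy n; rewrite -EFinM lee_fin.
Qed.

Lemma nondecreasing_ratio_lower (theta : {measure set (borelRd R d) -> \bar R}) c :
  nondecreasing_seq (fun m => ratio_lower mu nu q t theta E c (m.+1%:R^-1)%R).
Proof.
move=> m n mn; apply/subsetPset => x [Ex xr]; split => // r /andP[r0 rm]; apply: xr.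
by rewrite r0 (lt_le_trans rm)// lef_pV2 ?posrE// ler_nat.
Qed.

Lemma nondecreasing_ratio_upper (theta : {measure set (borelRd R d) -> \bar R}) c :
  nondecreasing_seq (fun m => ratio_upper mu nu q t theta E c (m.+1%:R^-1)%R).
Proof.
move=> m n mn; apply/subsetPset => x [Ex xr]; split => // r /andP[r0 rm]; apply: xr.
by rewrite r0 (lt_le_trans rm)// lef_pV2 ?posrE// ler_nat.
Qed.

Lemma packing_null_sub (A B : set 'rV[R]_d) : A `<=` B -> P B = 0 -> P A = 0.
Proof.
by move=> AB B0; apply/eqP; rewrite eq_le packing_ge0 andbT -B0 le_packing.
Qed.

(** Exhaust [F] by the sets where the ratio is at least [lo n] for all radii
below [1 / m], to which [packing_le_lower] applies. *)
Lemma packing_le_of_hausdorff_density (F : set (borelRd R d)) :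
  packing_ae mu nu q t E (fun x => 1 <= Hlow x) -> measurable F -> F `<=` E ->
  P F <= H F.
Proof.
move=> ae mF FE; have [theta thetaE] := hausdorff_restriction mu nu q t mE.
have HE : H E < +oo by apply: le_lt_trans PE; exact: (hausdorff_le_packing mE PE (@subset_refl _ E)).
have theta_fin := restriction_finite thetaE HE.
apply: le_of_lo_le; [by apply: le_lt_trans PE; exact: le_packing|exact: hausdorff_ge0|].
move=> n; have /andP[l0 l1] := @lo_bounds R n.
apply: (@packing_le_exhaust F
    (fun m => ratio_lower mu nu q t theta E (lo n) (m.+1%:R^-1)%R)) => //.
- by move=> m; exact: ratio_lower_measurable.
- exact: nondecreasing_ratio_lower.
- apply: packing_null_sub ae => x [Fx nG]; split; first exact: FE.
  move=> xl; apply: nG; have lx : (lo n)%:E < Hlow x by rewrite (lt_le_trans _ xl)// lte_fin.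
  have [s s0 sP] := lower_density_gt theta_fin ES thetaE (FE _ Fx) lx.
  have [m ms] := inv_lt_pos s0; exists m => //; split; first exact: FE.
  by move=> r /andP[r0 rm]; apply: sP; rewrite r0 (lt_trans rm).
move=> m; set G := ratio_lower _ _ _ _ _ _ _ _.
apply: (@le_trans _ _ (theta (F `&` G))).
  apply: (packing_le_lower ES mE theta_fin PE (s := (m.+1%:R^-1)%R) _ _ l0).
  - by apply: measurableI => //; exact: ratio_lower_measurable.
  - by move=> x [/FE].
  - by rewrite invr_gt0 ltr0n.
  - move=> x r [_ [Ex xr]] rm; rewrite -(ratio_lowerP _ _ _ ES) ?(andP rm).1//.
    exact: xr.
by rewrite thetaE; apply: le_hausdorff => x [_ []].
Qed.

(** Exhaust [F] by the sets where the ratio is at most [(lo n)^-1] for all radii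
below [1 / m], to which [outer_le_hausdorff_pre] applies. *)
Lemma packing_le_of_packing_density (F : set (borelRd R d)) :
  packing_ae mu nu q t E (fun x => Pup x <= 1) -> measurable F -> F `<=` E ->
  P F <= H F.
Proof.
move=> ae mF FE; have [theta thetaE] := packing_restriction mu nu q t mE.
have theta_fin := restriction_finite thetaE PE.
apply: le_of_lo_le; [by apply: le_lt_trans PE; exact: le_packing|exact: hausdorff_ge0|].
move=> n; have /andP[l0 l1] := @lo_bounds R n.
have c1 : (1 < (@lo R n)^-1)%R by rewrite invf_gt1.
apply: (@packing_le_exhaust F
    (fun m => ratio_upper mu nu q t theta E (lo n)^-1%R (m.+1%:R^-1)%R)) => //.
- by move=> m; exact: ratio_upper_measurable.
- exact: nondecreasing_ratio_upper.
- apply: packing_null_sub ae => x [Fx nG]; split; first exact: FE.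
  move=> xl; apply: nG; have lx : Pup x < ((lo n)^-1)%:E by rewrite (le_lt_trans xl)// lte_fin.
  have [s s0 sP] := upper_density_lt theta_fin ES thetaE (FE _ Fx) lx.
  have [m ms] := inv_lt_pos s0; exists m => //; split; first exact: FE.
  by move=> r /andP[r0 rm]; apply: sP; rewrite r0 (lt_trans rm).
move=> m; set G := ratio_upper _ _ _ _ _ _ _ _.
rewrite -lee_pdivlMl//.
apply: (@le_trans _ _ (((lo n)^-1)%:E * hausdorff_pre mu nu q t (F `&` G))); last first.
  apply: lee_wpmul2l; first by rewrite lee_fin invr_ge0 ltW.
  by apply: hausdorff_pre_le; exact: subIsetl.
apply: (outer_le_hausdorff_pre (s := (m.+1%:R^-1)%R) ES theta_fin thetaE).
- by move=> x [/FE].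
- by rewrite invr_gt0.
- by rewrite invr_gt0 ltr0n.
- move=> x r [_ [Ex xr]] rm; rewrite -(ratio_upperP _ _ _ ES) ?(andP rm).1//.
  exact: xr.
Qed.

Lemma equal_of_packing_le :
  (forall F : set (borelRd R d), measurable F -> F `<=` E -> P F <= H F) ->
  forall F : set (borelRd R d), measurable F -> F `<=` E -> H F = P F.
Proof.
move=> h F mF FE; apply/eqP; rewrite eq_le h// andbT.
exact: (hausdorff_le_packing mE PE FE).
Qed.

Section equal_measures.
Hypothesis HP : forall F : set (borelRd R d), measurable F -> F `<=` E -> H F = P F.

Let HPball x (r : R) : H (E `&` ecball x r) = P (E `&` ecball x r).
Proof. by apply: HP => [|y []//]; apply: measurableI => //; exact: ecball_measurable. Qed.

Lemma equal_upper_density x : Hup x = Pup x.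
Proof.
rewrite /hausdorff_upper_density /packing_upper_density /upper_density.
by congr (limf_esup _ _); apply/funext => r; rewrite HPball.
Qed.

Lemma equal_lower_density x : Hlow x = Plow x.
Proof.
rewrite /hausdorff_lower_density /packing_lower_density /lower_density.
by congr (limf_einf _ _); apply/funext => r; rewrite HPball.
Qed.

(** Where the lower density is one the upper density is at least one, so only
the set where it exceeds one has to be excluded; that set is covered by
Borel sets that are null for the common measure. *)
Lemma equal_hausdorff_density_ae :
  packing_ae mu nu q t E (fun x => Hup x = 1 /\ Hlow x = 1).
Proof.
have HE : H E < +oo by rewrite HP.
have [theta thetaE] := hausdorff_restriction mu nu q t mE.
have theta_fin := restriction_finite thetaE HE.
apply: (@outer_nullU _ _ _ _ [set x | E x /\ ~ (Plow x = 1)] [set x | E x /\ 1 < Hup x]).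
- move=> x [Ex nx]; have [/eqP P1|] := boolP (Plow x == 1); last by left; split => //; exact/eqP.
  right; split => //; rewrite lt_neqAle; apply/andP; split.
    by apply/eqP => Hup1; apply: nx; rewrite -Hup1 equal_lower_density P1.
  by rewrite -P1 -equal_lower_density lower_le_upper_density.
- exact: packing_lower_density_eq1.
apply: (@outer_null_bigcup _ _ _ _ _ (hausdorff_upper_gt1_cover ES thetaE theta_fin)) => n.
transitivity (H (ratio_often_above mu nu q t theta E (hi n))).
  by apply/esym/HP; [exact: ratio_often_above_measurable|move=> x []].
exact: hausdorff_often_above_hi_null.
Qed.

Lemma equal_packing_density_ae :
  packing_ae mu nu q t E (fun x => Pup x = 1 /\ Plow x = 1).
Proof.
apply: packing_null_sub equal_hausdorff_density_ae => x [Ex nx]; split => //.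
by rewrite equal_upper_density equal_lower_density.
Qed.

End equal_measures.

End equality.

Local Open Scope ereal_scope.

Theorem theorem4p2 (R : realType) (d k : nat) (hd : (0 < d)%N) (hk : (0 < k)%N)
    (mu : 'I_k -> probability (borelRd R d) R)
    (nu : probability (borelRd R d) R)
    (alpha : R) (halpha : (0 < alpha)%R) (hnu : quasi_ahlfors nu alpha)
    (q : 'I_k -> R) (t : R)
    (E : set (borelRd R d)) (mE : measurable E)
    (hE : E `<=` msupport_vec mu `&` msupport nu) :
  let H := hausdorff mu nu q t in
  let P := packing mu nu q t in
  let Dup := hausdorff_upper_density mu nu q t E in
  let Dlow := hausdorff_lower_density mu nu q t E in
  let Deltaup := packing_upper_density mu nu q t E in
  let Deltalow := packing_lower_density mu nu q t E in
  let Klow := [set x | E x /\ Dlow x = 1] in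
  let Kup := [set x | E x /\ Dup x = 1] in
  let Tlow := [set x | E x /\ Deltalow x = 1] in
  let Tup := [set x | E x /\ Deltaup x = 1] in
  let K := Klow `&` Kup in
  let T := Tup `&` Tlow in
  let PD := doubling mu /\ doubling (fun _ : 'I_1 => nu) in
  (0 < H E -> H E < +oo -> PD -> hausdorff_dim mu nu q Kup = t%:E) /\
  (0 < P E -> P E < +oo -> packing_dim mu nu q Tlow = t%:E) /\
  (P E < +oo -> PD ->
    let a := forall F : set (borelRd R d), measurable F -> F `<=` E ->
               H F = P F in
    let b := packing_ae mu nu q t E (fun x => Dup x = 1 /\ Dlow x = 1) in
    let c := packing_ae mu nu q t E
               (fun x => Deltaup x = 1 /\ Deltalow x = 1) in
    (a <-> b) /\ (b <-> c)) /\
  (0 < H E ->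
    (forall F : set (borelRd R d), measurable F -> F `<=` E ->
      H F = P F /\ P F < +oo) ->
    PD ->
    hausdorff_dim mu nu q K = t%:E /\ hausdorff_dim mu nu q T = t%:E).
Proof.
move=> H P Dup Dlow Deltaup Deltalow Klow Kup Tlow Tup K T PD.
have HAfin A : A `<=` E -> (H E < +oo)%E -> (H A < +oo)%E.
  by move=> AE; apply: le_lt_trans; exact: le_hausdorff.
split; last split; last split.
- move=> H0 Hoo _; have KE : Kup `<=` E by move=> x [].
  apply: (hausdorff_dim_eq hd halpha hnu hE KE); last exact: HAfin.
  exact: null_compl_pos (hausdorff_upper_density_eq1 hE mE Hoo).
- move=> P0 Poo; have TE : Tlow `<=` E by move=> x [].
  apply: (packing_dim_eq hd halpha hnu hE TE); last first.
    by apply: le_lt_trans Poo; exact: le_packing.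
  exact: null_compl_pos (packing_lower_density_eq1 hE mE Poo).
- move=> Poo _ a b c.
  have ab : a -> b by move=> ha; exact: equal_hausdorff_density_ae.
  have ac : a -> c by move=> ha; exact: equal_packing_density_ae.
  have ba : b -> a.
    move=> hb; apply: equal_of_packing_le => // F mF FE.
    apply: (packing_le_of_hausdorff_density hE mE Poo _ mF FE).
    apply: (@packing_null_sub R d k mu nu q t _ _ _ hb) => x [Ex nx]; split => // -[_ Dl].
    by apply: nx; rewrite -/(Dlow x) Dl.
  have ca : c -> a.
    move=> hc; apply: equal_of_packing_le => // F mF FE.
    apply: (packing_le_of_packing_density hE mE Poo _ mF FE).
    apply: (@packing_null_sub R d k mu nu q t _ _ _ hc) => x [Ex nx]; split => // -[Du _].
    by apply: nx; rewrite -/(Deltaup x) Du.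
  split; split; [exact: ab|exact: ba| |].
  + by move=> /ba /ac.
  + by move=> /ca /ab.
- move=> H0 HP _.
  have HPeq (F : set (borelRd R d)) : measurable F -> F `<=` E -> H F = P F.
    by move=> mF FE; have [] := HP F mF FE.
  have [HPE Poo] := HP E mE (@subset_refl _ _).
  have Hoo : (H E < +oo)%E by rewrite HPE.
  split.
  + have KE : K `<=` E by move=> x [[]].
    apply: (hausdorff_dim_eq hd halpha hnu hE KE); last exact: HAfin.
    have := null_compl_pos H0 (packing_null_hausdorff_null (equal_hausdorff_density_ae hE mE Poo HPeq)).
    by move/lt_le_trans; apply; apply: le_hausdorff => x [Ex [xu xl]].
  + have TE : T `<=` E by move=> x [[]].
    apply: (hausdorff_dim_eq hd halpha hnu hE TE); last exact: HAfin.
    have := null_compl_pos H0 (packing_null_hausdorff_null (equal_packing_density_ae hE mE Poo HPeq)).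
    by move/lt_le_trans; apply; apply: le_hausdorff => x [Ex [xu xl]].
Qed.
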